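(* Assume (A) and (C) below. Consider the testing rule which rejects $H_{0i}$ iff $\bar X_i$ falls out of the interval $(\tilde a_n,\tilde b_n)$, where $\tilde a_n<0<\tilde b_n$ are nonrandom. Let $v=n\delta^2f^2$ and define $z_a,z_b$ by $$\frac{n\tilde a_n^2}{\sigma^2}=\log v+z_a,\qquad \frac{n\tilde b_n^2}{\sigma^2}=\log v+z_b .$$ Then this rule is ABOS if and only if $$z_a=o(\log v),\qquad z_b=o(\log v),$$ and $$\lim_{n\to\infty}\left(z_a+2\log\log v\right)=\infty,\qquad \lim_{n\to\infty}\left(z_b+2\log\log v\right)=\infty .$$
   Context: Setting. All quantities are indexed by $m$ and all limits are for $m\to\infty$ (with $n=n_m\to\infty$); the index $m$ is suppressed. $n=n_m\in\mathbb N$, $p=p_m\in(0,1)$, $\delta_0,\delta_A>0$ may depend on $m$; $\sigma>0$ and $\nu$ are fixed, where $\nu$ is a probability measure on $\mathbb R$ with $\nu(\{0\})=0$, $\nu(-\infty,0)>0$, $\nu(0,\infty)>0$. The effects $\mu_1,\dots,\mu_m$ are i.i.d. with law $(1-p)d_0+p\nu$ ($d_0$ = Dirac measure at $0$); given them, $X_{ji}$ ($1\le j\le n$, $1\le i\le m$) are independent with $X_{ji}\sim N(\mu_i,\sigma^2)$, and $\bar X_i=\frac1n\sum_{j=1}^nX_{ji}$. One tests $H_{0i}:\mu_i=0$ against $\mu_i\ne0$, $i=1,\dots,m$. Put $\delta=\delta_0/\delta_A$, $f=(1-p)/p$. The risk $R$ of a multiple testing rule is $\delta_0$ times the expected number of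 false rejections plus $\delta_A$ times the expected number of false non-rejections; for a fixed threshold rule $R=m(1-p)t_1\delta_0+mpt_2\delta_A$, with $t_1,t_2$ the type I and type II error probabilities of an individual test. Bayes oracle: for large $n$ it accepts $H_{0i}$ iff $\bar X_i\in(a_n,b_n)$, where $a_n<0<b_n$ are the unique solutions $a$ of $(1-p)\delta_0=p\,\delta_A\int_{\mathbb R}\exp\left(n\left(a\frac{\mu}{\sigma^2}-\frac{\mu^2}{2\sigma^2}\right)\right)d\nu(\mu)$; it minimizes the risk, and its risk is $R^B$. A rule with risk $R$ is ABOS (asymptotically Bayes optimal under sparsity) if $R/R^B\to1$. Assumption (A): $n\to\infty$, $\delta f\to c\in(0,\infty]$, and $\frac{2\log(\delta f)}{n}\to C$ with $0\le C<\infty$. Assumption (C): with $T:=\sigma\sqrt C$, there is $\epsilon>0$ such that $\nu$ has a positive bounded density $\rho$ w.r.t. Lebesgue measure on $[-T-\epsilon,-T+\epsilon]$ and $[T-\epsilon,T+\epsilon]$; if $C=0$, moreover $\rho(0^-)=\lim_{\mu\uparrow0}\rho(\mu)$ and $\rho(0^+)=\lim_{\mu\downarrow0}\rho(\mu)$ exist and are finite and positive. *)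

(* Defs.v *)
From mathcomp Require Export all_boot all_order all_algebra.
From mathcomp Require Export all_classical all_reals all_analysis.
Export Order.TTheory GRing.Theory Num.Theory.
Export numFieldNormedType.Exports.

Set Implicit Arguments.
Unset Strict Implicit.
Unset Printing Implicit Defensive.

Local Open Scope classical_set_scope.
Local Open Scope ring_scope.

Definition admissible_effect_law {R : realType}
    (nu : probability (measurableTypeR R) R) : Prop :=
  [/\ nu [set (0 : R)%R] = 0%E,
      (0 < nu [set x : R | (x < 0)%R])%E &
      (0 < nu [set x : R | (0 < x)%R])%E].

Definition effect_law {R : realType} (p : R)
    (nu : probability (measurableTypeR R) R) (A : set R) : \bar R :=
  ((1 - p)%:E * \d_(0 : R)%R A + p%:E * nu A)%E.

(** The first clause says that the effects are i.i.d. with law [effect_law].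
    The second one gives the conditional law of the data given the effects,
    by integrating the product of normal laws over every cylinder event
    of the effects; [normal_prob] takes the standard deviation as its second
    argument. *)
Definition two_groups_model {R : realType} {d : measure_display}
    {Omega : measurableType d} (P : probability Omega R) {m n : nat}
    (p sigma : R) (nu : probability (measurableTypeR R) R)
    (mu : 'I_m -> {RV P >-> R}) (X : 'I_n -> 'I_m -> {RV P >-> R}) : Prop :=
  (forall A : 'I_m -> set R, (forall i, measurable (A i)) ->
     P [set w | forall i, A i (mu i w)]
     = (\prod_(i < m) effect_law p nu (A i))%E) /\
  (forall (A : 'I_m -> set R) (B : 'I_n -> 'I_m -> set R),
     (forall i, measurable (A i)) -> (forall j i, measurable (B j i)) ->
     P [set w | (forall i, A i (mu i w)) /\ (forall j i, B j i (X j i w))]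
     = (\int[P]_(w in [set w | forall i, A i (mu i w)])
          \prod_(i < m) \prod_(j < n) normal_prob (mu i w) sigma (B j i))%E).

Definition sample_mean {R : realType} {Omega : Type} {m n : nat}
    (X : 'I_n -> 'I_m -> Omega -> R) (i : 'I_m) (w : Omega) : R :=
  n%:R^-1 * \sum_(j < n) X j i w.

(** A testing rule is a function to [bool]; [true] stands for rejection. *)
Definition interval_rule {R : realType} {Omega : Type} {m n : nat}
    (X : 'I_n -> 'I_m -> Omega -> R) (a b : R) (i : 'I_m) (w : Omega) : bool :=
  ~~ (a < sample_mean X i w < b).

Definition false_rejections {R : realType} {Omega : Type} {m : nat}
    (mu : 'I_m -> Omega -> R) (rejects : 'I_m -> Omega -> bool)
    (w : Omega) : nat :=
  #|[pred i | (mu i w == 0) && rejects i w]|.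

Definition false_nonrejections {R : realType} {Omega : Type} {m : nat}
    (mu : 'I_m -> Omega -> R) (rejects : 'I_m -> Omega -> bool)
    (w : Omega) : nat :=
  #|[pred i | (mu i w != 0) && ~~ rejects i w]|.

Definition risk {R : realType} {d : measure_display} {Omega : measurableType d}
    (P : probability Omega R) {m : nat} (delta0 deltaA : R)
    (mu : 'I_m -> Omega -> R) (rejects : 'I_m -> Omega -> bool) : R :=
  delta0 * fine ('E_P[fun w => (false_rejections mu rejects w)%:R])%E
  + deltaA * fine ('E_P[fun w => (false_nonrejections mu rejects w)%:R])%E.

(** [x] solves the equation whose two solutions are the endpoints of the
    acceptance interval of the Bayes oracle. *)
Definition oracle_equation {R : realType} (n : nat) (p delta0 deltaA sigma : R)
    (nu : probability (measurableTypeR R) R) (x : R) : Prop :=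
  (((1 - p) * delta0)%:E
   = (p * deltaA)%:E *
     \int[nu]_t
       (expR (n%:R * (x * (t / sigma ^+ 2) - t ^+ 2 / (2 * sigma ^+ 2))))%:E)%E.

Definition oracle_thresholds {R : realType} (n : nat)
    (p delta0 deltaA sigma : R) (nu : probability (measurableTypeR R) R)
    (a b : R) : Prop :=
  [/\ a < 0, 0 < b,
      oracle_equation n p delta0 deltaA sigma nu a &
      oracle_equation n p delta0 deltaA sigma nu b].

Definition ABOS {R : realType} (rsk oracle_rsk : nat -> R) : Prop :=
  (rsk m / oracle_rsk m) @[m --> \oo] --> (1 : R).

(** [df] is the sequence [delta * f]. *)
Definition assumptionA {R : realType} (n : nat -> nat) (df : nat -> R)
    (c : \bar R) (C : R) : Prop :=
  [/\ n m @[m --> \oo] --> \oo,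
      (0 < c)%E,
      (df m)%:E @[m --> \oo] --> c,
      0 <= C &
      (2 * ln (df m) / (n m)%:R) @[m --> \oo] --> C].

Definition density_on {R : realType} (nu : probability (measurableTypeR R) R)
    (U : set R) (rho : R -> R) : Prop :=
  measurable_fun U rho /\
  forall A : set R, measurable A -> A `<=` U ->
    nu A = (\int[lebesgue_measure]_(x in A) (rho x)%:E)%E.

Definition assumptionC {R : realType} (nu : probability (measurableTypeR R) R)
    (sigma C : R) : Prop :=
  let T := sigma * Num.sqrt C in
  exists (eps : R) (rho : R -> R),
    let U := `[- T - eps, - T + eps] `|` `[T - eps, T + eps] in
    [/\ 0 < eps,
        density_on nu U rho,
        forall x, U x -> 0 < rho x,
        exists M : R, forall x, U x -> rho x <= M &
        C = 0 ->
        exists l r : R,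
          [/\ 0 < l, 0 < r,
              rho x @[x --> 0^'-] --> l &
              rho x @[x --> 0^'+] --> r]].

(* Main.v *)
Require Import Defs.
From HB Require Import structures.
From mathcomp Require Import ring lra measurable_realfun giry.
Import HBNNSimple.

(** Given its effect, the sample mean of a test is normal with standard
    deviation [e = sigma / sqrt n] ([sample_mean_law]).  Hence the risk of the
    rule with the thresholds [x < 0 < y], divided by [m * p * deltaA], is
<<
      delta f * (type I error) + (type II error),
>>
    where the type I error is a sum of two normal tails and the type II error
    is the probability of acceptance for an effect with law [nu]
    ([risk_interval_rule]).

    Put [L = log v] and [s = sigma * sqrt (L / n) = e * sqrt L].  Three facts
    determine this cost up to [o(s)].
    - The density of [nu] near the limits of [- s] and [s] makes the mass of
      the segment from [- s] to [s] of exact order [s], continuous and strictly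
      increasing in its endpoints at this scale ([assumptionC_regular]).
    - The noise [e = s / sqrt L] is small in comparison with [s], so the type II
      error is the mass of the acceptance interval up to [o(s)]
      ([type2_lower_bound], [type2_upper_bound], [type2_gain]).
    - For a threshold [b * s] with [z = L * (b ^+ 2 - 1)], Mills' inequalities
      and [delta f = sqrt (v / n)] give a type I cost of order
      [s * expR (- (z + 2 log L) / 2)] when [b] stays away from 0 and infinity
      ([type1_tail_ub], [type1_tail_lb]).

    A threshold below [(1 - k) * s] with [k > 0] fixed costs more than any
    multiple of [s], because then [z + 2 log L] tends to [-oo] linearly in [L];
    so no rule costs less than the mass of the segment from [- s] to [s] minus
    [o(s)] ([cost_lower_bound]).  The rule with the thresholds [- s] and [s] has
    [z = 0] and attains this bound.  The oracle is at least as good as this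
    rule: the likelihood ratio of the sample mean, averaged over [nu], is a
    convex function, so the oracle accepts exactly where acceptance is the
    cheaper decision ([oracle_interval_optimal]).  Since the optimal cost is of
    exact order [s], a rule is ABOS iff its cost exceeds the bound by [o(s)] only
    ([ratio_cvg1_near_optimal]).  This means that the type I cost is [o(s)], that
    is, [z + 2 log L] tends to [+oo] for both thresholds, and that no mass of
    order [s] is accepted beyond [- s] and [s], that is, both thresholds are at
    most [(1 + o(1)) * s] ([near_optimal_thresholds]).  The first condition
    implies [z >= - o(L)] and the second is [z <= o(L)]
    ([threshold_conditions]). *)

Set Implicit Arguments.
Unset Strict Implicit.
Unset Printing Implicit Defensive.

Local Open Scope classical_set_scope.
Local Open Scope ring_scope.

(** * Affine images and sums of normal laws *)

(** Both integrals are limits along one increasing sequence of simple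
    functions, and for simple functions the identity is linearity. *)
Lemma ge0_integral_density {R : realType} {d} {T : measurableType d}
    (mu nu : {measure set T -> \bar R}) (g : T -> R) (f : T -> \bar R) :
  measurable_fun setT g -> (forall x, 0 <= g x) ->
  (forall A, measurable A -> nu A = (\int[mu]_(x in A) (g x)%:E)%E) ->
  measurable_fun setT f -> (forall x, 0 <= f x)%E ->
  (\int[nu]_x f x = \int[mu]_x (f x * (g x)%:E))%E.
Proof.
move=> mg g0 nuE mf f0.
have mgE : measurable_fun setT (EFin \o g) by exact/measurable_EFinP.
pose f_ := nnsfun_approx measurableT mf.
have f_cvg x : ((f_ n x)%:E @[n --> \oo] --> f x)%E.
  by apply: cvg_nnsfun_approx => // *; exact: f0.
transitivity (limn (fun n => \int[nu]_x (f_ n x)%:E)%E).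
  rewrite -monotone_convergence//.
  - by apply: eq_integral => x _; apply/esym/cvg_lim.
  - by move=> n; exact/measurable_EFinP.
  - by move=> n x _; rewrite lee_fin.
  - by move=> x _ a b ab; rewrite lee_fin; exact/lefP/nd_nnsfun_approx.
transitivity (limn (fun n => \int[mu]_x ((f_ n x)%:E * (g x)%:E))%E); last first.
  rewrite -monotone_convergence//.
  - apply: eq_integral => x _; apply/cvg_lim => //.
    by apply: cvgeZr.
  - by move=> n; apply: emeasurable_funM => //; exact/measurable_EFinP.
  - by move=> n x _; rewrite -EFinM lee_fin mulr_ge0.
  - move=> x _ a b ab; rewrite -!EFinM lee_fin ler_wpM2r//.
    exact/lefP/nd_nnsfun_approx.
congr (limn _); apply/funext => n.
under eq_integral do rewrite fimfunE -fsumEFin//.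
rewrite ge0_integral_fsum//; last 2 first.
- by move=> y; exact/measurable_EFinP/measurable_funM.
- by move=> y x _; rewrite nnfun_muleindic_ge0.
transitivity (\int[mu]_x
    (\sum_(r \in range (f_ n)) ((r * \1_(f_ n @^-1` [set r]) x * g x)%:E)))%E.
  rewrite ge0_integral_fsum//; last 2 first.
  - move=> y; apply/measurable_EFinP/measurable_funM => //.
    by apply: measurable_funM.
  - move=> y x _; rewrite EFinM mule_ge0 ?lee_fin//.
    by have := nnfun_muleindic_ge0 (f_ n) y x; rewrite -EFinM lee_fin.
  apply: eq_fsbigr => r _.
  have mfr : measurable (f_ n @^-1` [set r]) by [].
  rewrite integralZl_indic_nnsfun// integral_indic// setIT nuE//.
  have [r0|r0] := ltP r 0.
    rewrite preimage_nnfun0// integral_set0 mule0.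
    by rewrite integral0_eq// => x _; rewrite indicE in_set0 mulr0 mul0r.
  under [in RHS]eq_integral do rewrite -mulrA EFinM.
  rewrite ge0_integralZl//; last 2 first.
    apply/measurable_EFinP/measurable_funM => //.
    by move=> x _; rewrite lee_fin mulr_ge0.
  congr (_ * _)%E; rewrite [LHS]integral_mkcond; apply: eq_integral => x _.
  rewrite patchE indicE.
  by case: ifP; rewrite ?mul1r ?mul0r.
apply: eq_integral => x _; rewrite [in RHS]fimfunE -EFinM.
by rewrite fsumEFin// mulrC mulr_fsumr; congr (EFin _); apply: eq_fsbigr => y _; rewrite mulrC.
Qed.

Lemma lebesgue_measure_affine {R : realType} (a b : R) (A : set R) :
  0 < a -> measurable A ->
  @lebesgue_measure R ((fun x => a * x + b) @^-1` A)
  = (a^-1%:E * lebesgue_measure A)%E.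
Proof.
move=> a0 mA.
pose phi : measurableTypeR R -> measurableTypeR R := fun x => a * x + b.
have mphi : measurable_fun setT phi.
  by apply: measurable_funD => //; exact: measurable_funM.
pose an : {nonneg R} := NngNum (ltW a0).
pose pushE : {measure set (measurableTypeR R) -> \bar R} :=
  pushforward (@lebesgue_measure R) phi.
pose m' : {measure set (measurableTypeR R) -> \bar R} := mscale an (pushE mphi).
suff -> : lebesgue_measure A = m' A.
  rewrite /m'/= /mscale/= muleA -EFinM mulVf ?gt_eqF// mul1e.
  by [].
apply: lebesgue_measure_unique => // _ [[u w]] _ <-.
rewrite /m'/= /mscale/= /pushforward/=.
have -> : phi @^-1` `]u, w]%classic = `](u - b) / a, (w - b) / a]%classic.
  apply/seteqP; split => x /=; rewrite !in_itv/= /phi ltr_pdivrMr// ler_pdivlMr//.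
    by rewrite ltrBlDr lerBrDr [x * a]mulrC.
  by rewrite ltrBlDr lerBrDr [x * a]mulrC.
rewrite !lebesgue_measure_itv/= !lte_fin ltr_pM2r ?invr_gt0// ltrD2r.
case: ifP; rewrite ?mule0// => _; rewrite -EFinM; congr EFin.
by field; rewrite gt_eqF.
Qed.

Lemma ge0_integral_affine {R : realType} (a b : R) (f : R -> \bar R) :
  0 < a -> measurable_fun setT f -> (forall x, 0 <= f x)%E ->
  (\int[lebesgue_measure]_x f (a * x + b)%R
   = a^-1%:E * \int[lebesgue_measure]_x f x)%E.
Proof.
move=> a0 mf f0.
pose phi : measurableTypeR R -> measurableTypeR R := fun x => a * x + b.
have mphi : measurable_fun setT phi.
  by apply: measurable_funD => //; exact: measurable_funM.
have ai0 : 0 <= a^-1 by rewrite invr_ge0 ltW.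
pose an : {nonneg R} := NngNum ai0.
rewrite -[LHS](@ge0_integral_pushforward _ _ _ _ R phi mphi lebesgue_measure setT f)//.
rewrite -(ge0_integral_mscale _ measurableT an)//.
apply: eq_measure_integral => A mA _.
exact: lebesgue_measure_affine.
Qed.

Lemma normal_prob_affine {R : realType} (m s a b : R) (B : set R) :
  0 < s -> 0 < a -> measurable B ->
  normal_prob m s ((fun y => a * y + b) @^-1` B)
  = normal_prob (a * m + b) (a * s) B.
Proof.
move=> s0 a0 mB; rewrite /normal_prob.
have as0 : a * s != 0 by rewrite mulf_neq0 ?gt_eqF.
have pdfE x : normal_pdf m s x
    = a * normal_pdf (a * m + b) (a * s) (a * x + b).
  rewrite !normal_pdfE// ?gt_eqF// /normal_peak /normal_fun.
  rewrite [_ ^+ 2 * pi *+ 2](_ : _ = s ^+ 2 * (pi *+ 2)); last by rewrite -mulrnAr.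
  rewrite [(a * s) ^+ 2 * pi *+ 2](_ : _ = a ^+ 2 * (s ^+ 2 * (pi *+ 2))); last first.
    by rewrite exprMn -mulrnAr mulrA.
  rewrite [in RHS]sqrtrM ?sqr_ge0// sqrtr_sqr gtr0_norm// mulrA invfM mulrA.
  rewrite divff ?gt_eqF// mul1r; congr (_ * expR _).
  by field; rewrite ?gt_eqF.
set f := fun y : R => ((a * normal_pdf (a * m + b) (a * s) y) * \1_B y)%:E.
rewrite [LHS]integral_mkcond /=.
transitivity (\int[lebesgue_measure]_x f (a * x + b)%R)%E.
  apply: eq_integral => x _; rewrite patchE /f /= indicE -[x \in _]/(a * x + b \in B).
  by case: ifP => _; rewrite ?mulr1 ?mulr0// pdfE.
rewrite ge0_integral_affine//; last 2 first.
- apply/measurable_EFinP; apply: measurable_funM => //.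
  by apply: measurable_funM => //; exact: measurable_normal_pdf.
- by move=> x; rewrite lee_fin mulr_ge0// mulr_ge0 ?normal_pdf_ge0// ltW.
rewrite -ge0_integralZl//; last 3 first.
- apply/measurable_EFinP; apply: measurable_funM => //.
  by apply: measurable_funM => //; exact: measurable_normal_pdf.
- by move=> x _; rewrite lee_fin mulr_ge0// mulr_ge0 ?normal_pdf_ge0// ltW.
- by rewrite lee_fin invr_ge0 ltW.
rewrite [RHS]integral_mkcond /=; apply: eq_integral => x _.
rewrite patchE /f indicE -EFinM !mulrA mulVf ?gt_eqF// mul1r.
by case: ifP => _; rewrite ?mulr1 ?mulr0.
Qed.

Lemma measurable_normal_pdf_pair {R : realType} {d} {T : measurableType d}
    (s : R) (f g : T -> R) : s != 0 ->
  measurable_fun setT f -> measurable_fun setT g ->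
  measurable_fun setT (fun t => normal_pdf (f t) s (g t)).
Proof.
move=> s0 mf mg; under eq_fun do rewrite normal_pdfE//.
apply: measurable_funM => //; apply: measurableT_comp => //=.
apply: measurable_funM => //; apply: measurableT_comp => //=.
by apply: measurable_funX => //; exact: measurable_funB.
Qed.

Lemma measurable_normal_prob {R : realType} (s : R) (B : set R) :
  s != 0 -> measurable B ->
  measurable_fun setT (fun m => normal_prob m s B : \bar R).
Proof.
move=> s0 mB.
pose F (z : measurableTypeR R * measurableTypeR R) : \bar R :=
  (normal_pdf z.1 s z.2 * \1_B z.2)%:E.
rewrite (_ : (fun _ => _) = fubini_F lebesgue_measure F); last first.
  apply/funext => m; rewrite /fubini_F /normal_prob [LHS]integral_mkcond.
  apply: eq_integral => x _; rewrite patchE /F /= indicE.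
  by case: ifP => _; rewrite ?mulr1 ?mulr0.
apply: measurable_fun_fubini_tonelli_F => //.
- apply/measurable_EFinP/measurable_funM.
    exact: measurable_normal_pdf_pair.
  exact: measurableT_comp.
- by move=> z; rewrite lee_fin mulr_ge0// normal_pdf_ge0.
Qed.

(** Completing the square in [x]: the joint density of a summand [x] and of
    the sum [z] is the density of [z] times the density of [x] given [z],
    which is again normal. *)
Lemma normal_pdf_convolution {R : realType} (m1 m2 s1 s2 x z : R) :
  0 < s1 -> 0 < s2 ->
  let s := Num.sqrt (s1 ^+ 2 + s2 ^+ 2) in
  normal_pdf m1 s1 x * normal_pdf (m2 + x) s2 z
  = normal_pdf (m1 + m2) s z
    * normal_pdf ((m1 * s2 ^+ 2 + (z - m2) * s1 ^+ 2) / s ^+ 2) (s1 * s2 / s) x.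
Proof.
move=> s10 s20 s.
have ss0 : 0 < s1 ^+ 2 + s2 ^+ 2 by rewrite addr_gt0// exprn_gt0.
have s0 : 0 < s by rewrite sqrtr_gt0.
have sE : s ^+ 2 = s1 ^+ 2 + s2 ^+ 2 by rewrite sqr_sqrtr// ltW.
rewrite !normal_pdfE ?gt_eqF// ?divr_gt0 ?mulr_gt0//.
rewrite /normal_peak /normal_fun.
rewrite mulrACA [RHS]mulrACA -!expRD -!invfM -!sqrtrM; last 2 first.
- by rewrite mulrn_wge0// mulr_ge0 ?sqr_ge0// pi_ge0.
- by rewrite mulrn_wge0// mulr_ge0 ?sqr_ge0// pi_ge0.
congr ((Num.sqrt _)^-1 * expR _).
  move: (@pi R) => q.
  by field; rewrite gt_eqF.
rewrite exprMn exprVn !sE.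
by field; rewrite ?gt_eqF//= -?expr2 ?gt_eqF.
Qed.

(** By Tonelli's theorem and the factorization above, the inner integral is
    the total mass of the conditional law of the first summand. *)
Lemma normal_prob_convolution {R : realType} (m1 m2 s1 s2 : R) (B : set R) :
  0 < s1 -> 0 < s2 -> measurable B ->
  (\int[normal_prob m1 s1]_x normal_prob m2 s2 ((fun y : R => (x : R) + y)%R @^-1` B)
   = normal_prob (m1 + m2)%R (Num.sqrt (s1 ^+ 2 + s2 ^+ 2)%R) B)%E.
Proof.
move=> s10 s20 mB; set s := Num.sqrt _.
have s0 : 0 < s by rewrite sqrtr_gt0 addr_gt0// exprn_gt0.
have shiftE x : normal_prob m2 s2 ((fun y => x + y) @^-1` B)
    = normal_prob (m2 + x) s2 B.
  rewrite -[m2]mul1r -[s2 in RHS]mul1r -normal_prob_affine// mul1r.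
  by congr (normal_prob _ _ _); apply/seteqP; split => y /=; rewrite mul1r addrC.
under eq_integral do rewrite shiftE.
have mshift : measurable_fun setT (fun x => normal_prob (m2 + x) s2 B : \bar R).
  apply: (measurableT_comp (measurable_normal_prob _ mB)); rewrite ?gt_eqF//.
  exact: measurable_funD.
rewrite (@ge0_integral_density _ _ _ lebesgue_measure _ (normal_pdf m1 s1))//;
  last 2 first.
- exact: measurable_normal_pdf.
- by move=> x; exact: normal_pdf_ge0.
pose F (z : measurableTypeR R * measurableTypeR R) : \bar R :=
  (normal_pdf m1 s1 z.1 * normal_pdf (m2 + z.1) s2 z.2 * \1_B z.2)%:E.
have mF : measurable_fun setT F.
  apply/measurable_EFinP/measurable_funM; last exact: measurableT_comp.
  apply: measurable_funM; apply: measurable_normal_pdf_pair; rewrite ?gt_eqF//.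
  exact: measurable_funD.
have F0 z : (0 <= F z)%E by rewrite lee_fin !mulr_ge0 ?normal_pdf_ge0.
transitivity (\int[lebesgue_measure]_x \int[lebesgue_measure]_y F (x, y))%E.
  apply: eq_integral => x _; rewrite /normal_prob integral_mkcond muleC.
  rewrite -ge0_integralZl//; last 3 first.
  - apply/(measurable_restrictT _ mB)/measurable_funTS/measurable_EFinP.
    exact: measurable_normal_pdf.
  - by move=> y _; rewrite patchE; case: ifP => _//; rewrite lee_fin normal_pdf_ge0.
  - by rewrite lee_fin normal_pdf_ge0.
  apply: eq_integral => y _; rewrite patchE /F /= indicE.
  by case: ifP => _; rewrite ?mulr1 ?mulr0 ?mule0 ?EFinM.
rewrite fubini_tonelli// [RHS]integral_mkcond; apply: eq_integral => y _.
rewrite patchE /F /= indicE; case: ifP => _; last first.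
  by rewrite integral0_eq// => x _; rewrite mulr0.
under eq_integral do rewrite mulr1 normal_pdf_convolution// EFinM.
rewrite ge0_integralZl//; last 3 first.
- by apply/measurable_EFinP; exact: measurable_normal_pdf.
- by move=> x _; rewrite lee_fin normal_pdf_ge0.
- by rewrite lee_fin normal_pdf_ge0.
by rewrite integral_normal_pdf mule1.
Qed.

(** * Joint laws from conditional laws *)

(** The sets [D] for which the identity holds form a Dynkin system, because
    both sides are measures in [D] of the same finite total mass.  The event
    [W] and the weight [c] keep track of the coordinates other than [Z]. *)
Lemma kernel_law_unique {R : realType} {d d1} {Om : measurableType d}
    {T : measurableType d1} (P : probability Om R) (W E : set Om)
    (c : Om -> \bar R) (K : Om -> {measure set T -> \bar R}) (Z : Om -> T)
    (G : set (set T)) :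
  @measurable _ T = <<s G >> -> setI_closed G -> G setT ->
  measurable W -> measurable E ->
  measurable_fun setT c -> (forall w, 0 <= c w)%E ->
  (forall w, c w \is a fin_num) ->
  (forall D, measurable D -> measurable_fun setT (fun w => K w D)) ->
  measurable_fun setT Z ->
  (forall D, G D -> P [set w | W w /\ D (Z w)]
     = (\int[P]_(w in E) (c w * K w D))%E) ->
  forall D, measurable D ->
    P [set w | W w /\ D (Z w)] = (\int[P]_(w in E) (c w * K w D))%E.
Proof.
move=> TG GI GT mW mE mc c0 cfin mK mZ GE.
have mpre D : measurable D -> measurable [set w | W w /\ D (Z w)].
  move=> mD; apply: measurableI => //.
  by rewrite -[X in measurable X]setTI; exact: mZ.
have mcK D : measurable D -> measurable_fun E (fun w => c w * K w D)%E.
  by move=> mD; apply: measurable_funTS; apply: emeasurable_funM => //; exact: mK.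
have cK0 D w : (0 <= c w * K w D)%E by rewrite mule_ge0.
pose Q : set_system T := fun D =>
  P [set w | W w /\ D (Z w)] = (\int[P]_(w in E) (c w * K w D))%E.
suff QG D : <<s G >> D -> Q D by move=> D; rewrite TG; exact: QG.
apply: (@dynkin_induction _ _ G Q TG GI); first exact: GE.
- by move=> A GA; exact: GE.
- move=> S mS HS.
  have mSC : measurable (~` S) by exact: measurableC.
  have PS : (P [set w | W w /\ S (Z w)] \is a fin_num)%E.
    by rewrite fin_num_measure//; exact: mpre.
  have : (P [set w | W w /\ S (Z w)] + P [set w | W w /\ (~` S) (Z w)]
      = \int[P]_(w in E) (c w * K w S) + \int[P]_(w in E) (c w * K w (~` S)))%E.
    rewrite -ge0_integralD//; last 2 first.
    + exact: mcK.
    + exact: mcK.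
    rewrite -measureU//; last 3 first.
    + exact: mpre.
    + exact: mpre.
    + by apply/seteqP; split => // w /= [[_ ?] []].
    transitivity (P [set w | W w /\ setT (Z w)]).
      congr (P _); apply/seteqP; split => w /=.
        by case=> -[].
      by case=> Ww _; have [?|?] := pselect (S (Z w)); [left|right].
    rewrite GE//; apply: eq_integral => w _.
    rewrite -ge0_muleDr//; congr (_ * _)%E.
    by rewrite -measureU ?setUv ?setICr.
  rewrite -HS => /(congr1 (fun x => x - P [set w | W w /\ S (Z w)])%E).
  by rewrite ![(P [set w | W w /\ S (Z w)] + _)%E]addeC !addeK.
- move=> F mF tF HF.
  have mUF : measurable (\bigcup_k F k) by exact: bigcup_measurable.
  rewrite /Q (_ : [set w | _] = \bigcup_k [set w | W w /\ F k (Z w)]); last first.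
    apply/seteqP; split => w /=; first by case=> Ww [k _ Fk]; exists k.
    by case=> k _ [Ww Fk]; split => //; exists k.
  rewrite measure_semi_bigcup//; last 3 first.
  + by move=> k; exact: mpre.
  + apply/trivIsetP => i j _ _ ij; apply/seteqP; split => // w /= [[_ Fi] [_ Fj]].
    by move/trivIsetP : tF => /(_ i j I I ij) => /seteqP[/(_ (Z w)) + _]; apply.
  + by apply: bigcup_measurable => k _; exact: mpre.
  rewrite (eq_eseriesr (fun k _ => HF k)).
  rewrite -integral_nneseries//; last by move=> k; exact: mcK.
  apply: eq_integral => w _.
  by rewrite measure_semi_bigcup// -[c w]fineK// nneseriesZl.
Qed.

(** Conditional independence is given on rectangles only, while the law of a
    sum involves the half-planes and strips of the product space. *)
Lemma joint_law_of_kernels {R : realType} {d d1 d2} {Om : measurableType d}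
    {T1 : measurableType d1} {T2 : measurableType d2}
    (P : probability Om R) (W E : set Om) (c : Om -> \bar R)
    (K1 : Om -> probability T1 R) (K2 : Om -> probability T2 R)
    (Z1 : Om -> T1) (Z2 : Om -> T2) :
  measurable W -> measurable E ->
  measurable_fun setT c -> (forall w, 0 <= c w)%E ->
  (forall w, c w \is a fin_num) ->
  (forall A, measurable A -> measurable_fun setT (fun w => K1 w A)) ->
  (forall B, measurable B -> measurable_fun setT (fun w => K2 w B)) ->
  measurable_fun setT Z1 -> measurable_fun setT Z2 ->
  (forall A B, measurable A -> measurable B ->
     P [set w | W w /\ A (Z1 w) /\ B (Z2 w)]
     = (\int[P]_(w in E) (c w * (K1 w A * K2 w B)))%E) ->
  forall D, measurable D ->
    P [set w | W w /\ D (Z1 w, Z2 w)]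
    = (\int[P]_(w in E) (c w * (K1 w \x K2 w)%E D))%E.
Proof.
move=> mW mE mc c0 cfin mK1 mK2 mZ1 mZ2 rectE.
have mg1 : measurable_fun setT (K1 : Om -> giry T1 R).
  exact: measurable_giry_codensity.
have mg2 : measurable_fun setT (K2 : Om -> giry T2 R).
  exact: measurable_giry_codensity.
have mg : measurable_fun setT (fun w => (K1 w : giry T1 R, K2 w : giry T2 R)).
  exact/measurable_fun_pairP.
apply: (kernel_law_unique
  (G := [set A `*` B | A in measurable & B in measurable]) _ _ _ mW mE mc c0 cfin).
- exact: measurable_prod_measurableType.
- move=> _ _ [A1 mA1 [A2 mA2 <-]] [B1 mB1 [B2 mB2 <-]].
  exists (A1 `&` B1); first exact: measurableI.
  exists (A2 `&` B2); first exact: measurableI.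
  by rewrite setXI.
- by exists setT => //; exists setT => //; rewrite setXTT.
- move=> D mD.
  exact: measurableT_comp (measurable_giry_ev mD)
    (measurableT_comp (@measurable_giry_prod _ _ T1 T2 R) mg).
- exact/measurable_fun_pairP.
- move=> _ [A mA [B mB <-]]; rewrite rectE//.
  apply: eq_integral => w _; congr (_ * _)%E.
  by rewrite [RHS]product_measure1E.
Qed.

(** * The sample mean in the two-groups model *)

Lemma normal_product_sum {R : realType} (m1 m2 s1 s2 : R) (B : set R) :
  0 < s1 -> 0 < s2 -> measurable B ->
  (((normal_prob m1 s1 : probability (measurableTypeR R) R)
    \x (normal_prob m2 s2 : probability (measurableTypeR R) R)) [set z | B (z.1 + z.2)%R]
   = normal_prob (m1 + m2)%R (Num.sqrt (s1 ^+ 2 + s2 ^+ 2)%R) B)%E.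
Proof.
move=> s10 s20 mB; rewrite -(normal_prob_convolution m1 m2 s10 s20 mB).
apply: eq_integral => x _ /=; congr (normal_prob _ _ _).
by apply/seteqP; split => y; rewrite xsectionP.
Qed.

Lemma emeasurable_prode {R : realType} {d} {T : measurableType d} {I : Type}
    (s : seq I) (p : pred I) (h : I -> T -> \bar R) :
  (forall i, measurable_fun setT (h i)) ->
  measurable_fun setT (fun x => (\prod_(i <- s | p i) h i x)%E).
Proof.
move=> mh; elim: s => [|i s IHs].
  by under eq_fun do rewrite big_nil; exact: measurable_cst.
under eq_fun do rewrite big_cons.
by case: (p i) => //; exact: emeasurable_funM.
Qed.

(** Induction on [k].  The step replaces the pair (partial sum, next
    observation) by its sum; the next observation is still available because
    the events of all later observations are part of the statement.  The
    induction starts at [k = 1], as a normal law with standard deviation 0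
    is not a point mass here. *)
Lemma partial_sum_law {R : realType} {d} {Om : measurableType d}
    (P : probability Om R) (n : nat) (sigma : R)
    (M : {RV P >-> R}) (X : 'I_n -> {RV P >-> R}) :
  0 < sigma ->
  (forall (A : set R) (B : 'I_n -> set R), measurable A ->
     (forall j, measurable (B j)) ->
     P [set w | A (M w) /\ forall j, B j (X j w)]
     = (\int[P]_(w in M @^-1` A) \prod_(j < n) normal_prob (M w) sigma (B j))%E) ->
  forall k, (0 < k <= n)%N ->
  forall (A B : set R) (C : 'I_n -> set R), measurable A -> measurable B ->
    (forall j, measurable (C j)) ->
    P [set w | A (M w) /\ B (\sum_(j < n | (j < k)%N) X j w)
               /\ forall j : 'I_n, (k <= j)%N -> C j (X j w)]
    = (\int[P]_(w in M @^-1` A)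
         ((\prod_(j < n | (k <= j)%N) normal_prob (M w) sigma (C j))
          * normal_prob (k%:R * M w)%R (Num.sqrt k%:R * sigma)%R B))%E.
Proof.
move=> s0 lawE; elim=> // k IHk kn A B C mA mB mC.
have kn' : (k < n)%N by case/andP: kn.
pose ik := Ordinal kn'.
have mMA : measurable (M @^-1` A) by rewrite -[X in measurable X]setTI; exact: measurable_funP.
have mN (s : R) (a : R) D : s != 0 -> measurable D ->
    measurable_fun setT (fun w => normal_prob (a * M w) s D : \bar R).
  move=> sn0 mD; apply: measurableT_comp (measurable_normal_prob sn0 mD) _.
  exact: measurable_funM.
have mN1 D : measurable D ->
    measurable_fun setT (fun w => normal_prob (M w) sigma D : \bar R).
  by move=> mD; apply: measurableT_comp (measurable_normal_prob _ mD) _; rewrite ?gt_eqF.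
have sumS w : \sum_(j < n | (j < k.+1)%N) X j w
    = \sum_(j < n | (j < k)%N) X j w + X ik w.
  rewrite (bigD1 ik)//= addrC; congr (_ + _); apply: eq_bigl => j.
  by rewrite ltnS -val_eqE/= [RHS]ltn_neqAle andbC.
(* The partial sum of length one is the first observation itself. *)
have [k0|k0] := posnP k.
  have kj (j : 'I_n) : (k < j)%N = (j != ik) by rewrite -val_eqE/= k0 lt0n.
  pose B' j := if j == ik then B else C j.
  rewrite (_ : [set w | _] = [set w | A (M w) /\ forall j, B' j (X j w)]).
    rewrite lawE//; last by move=> j; rewrite /B'; case: ifP.
    apply: eq_integral => w _; rewrite (bigD1 ik)//= muleC k0 mul1r sqrtr1 mul1r.
    rewrite /B' eqxx; congr (_ * _)%E.
    apply: eq_big => j; first by rewrite -kj k0.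
    by case: eqVneq.
  have sumX w : \sum_(j < n | (j < k.+1)%N) X j w = X ik w.
    by rewrite sumS big_pred0 ?add0r// => j; rewrite k0.
  apply/seteqP; split => w /=; rewrite sumX.
    move=> [Aw [Bw Cw]]; split=> // j; rewrite /B'.
    by have [->//|jk] := eqVneq j ik; apply: Cw; rewrite kj.
  move=> [Aw Bw]; split => //; split.
    by have := Bw ik; rewrite /B' eqxx.
  by move=> j; rewrite kj; have := Bw j; rewrite /B'; case: eqVneq.
have {}IHk := IHk _; rewrite k0 (ltnW kn') in IHk; move/(_ isT) : IHk => IHk.
(* [W] and [c] collect the effect and the observations after the next one. *)
pose W := [set w | A (M w) /\ forall j : 'I_n, (k.+1 <= j)%N -> C j (X j w)].
have mW : measurable W.
  rewrite (_ : W = M @^-1` A `&`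
      \bigcap_(j in [set j : 'I_n | (k.+1 <= j)%N]) (X j @^-1` C j)).
    apply: measurableI => //; apply: fin_bigcap_measurable => // j _.
    by rewrite -[X in measurable X]setTI; exact: measurable_funP.
  by apply/seteqP; split => w /=.
pose c w := (\prod_(j < n | (k.+1 <= j)%N) normal_prob (M w) sigma (C j))%E.
pose S w := \sum_(j < n | (j < k)%N) X j w.
have := @joint_law_of_kernels R d _ _ Om (measurableTypeR R) (measurableTypeR R)
  P W (M @^-1` A) c
  (fun w => normal_prob (k%:R * M w) (Num.sqrt k%:R * sigma))
  (fun w => normal_prob (M w) sigma) S (X ik) mW mMA.
have sk0 : 0 < Num.sqrt k%:R * sigma by rewrite mulr_gt0// sqrtr_gt0 ltr0n.
have mD : measurable [set z : measurableTypeR R * measurableTypeR R | B (z.1 + z.2)].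
  rewrite -[X in measurable X]setTI.
  suff : measurable_fun setT (fun z : measurableTypeR R * measurableTypeR R => z.1 + z.2 : R).
    by apply.
  exact: measurable_funD.
move=> /(_ _ _ _ _ _ _ _ _ _ mD) H.
rewrite (_ : [set w | _] = [set w | W w /\ [set z | B (z.1 + z.2)] (S w, X ik w)]); last first.
  apply/seteqP; split => w /=; rewrite sumS.
    by move=> [? [? ?]]; split.
  by move=> [[? ?] ?]; split.
rewrite H.
- apply: eq_integral => w _; congr (_ * _)%E.
  have meanE : k%:R * M w + M w = k.+1%:R * M w.
    by rewrite -[k.+1%:R]natr1 mulrDl mul1r.
  have sdE : Num.sqrt ((Num.sqrt k%:R * sigma) ^+ 2 + sigma ^+ 2)
      = Num.sqrt k.+1%:R * sigma.
    rewrite exprMn sqr_sqrtr// -[X in _ + X]mul1r -mulrDl natr1.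
    by rewrite sqrtrM// sqrtr_sqr gtr0_norm.
  have := normal_product_sum (k%:R * M w) (M w) sk0 s0 mB.
  by rewrite /product_measure1 /= meanE sdE => ->.
- by apply: emeasurable_prode => j; exact: (mN1 _ (mC j)).
- by move=> w; apply: prode_ge0 => j _; exact: measure_ge0.
- by move=> w; apply: prode_fin_num => j _; rewrite fin_num_measure//; exact: mC.
- by move=> D mD'; apply: mN => //; rewrite gt_eqF.
- by move=> D mD'; exact: mN1.
- rewrite /S; under eq_fun do rewrite big_mkcond/=.
  apply: measurable_sum => j.
  by case: (j < k)%N; [exact: measurable_funP|exact: measurable_cst].
- exact: (@measurable_funP _ _ _ _ setT (X ik)).
- move=> D1 D2 mD1 mD2.
  pose C' j := if j == ik then D2 else C j.
  have mC' j : measurable (C' j) by rewrite /C'; case: ifP => _; [|exact: mC].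
  rewrite (_ : [set w | _] = [set w | A (M w) /\ D1 (S w)
      /\ forall j : 'I_n, (k <= j)%N -> C' j (X j w)]).
    rewrite IHk//; apply: eq_integral => w _.
    rewrite (bigD1 ik)//= /C' eqxx muleAC [RHS]muleC.
    have cE : (\prod_(i < n | (k <= i)%N && (i != ik))
        normal_prob (M w) sigma (if i == ik then D2 else C i))%E = c w.
      rewrite /c; apply: eq_big => j.
        by rewrite ltn_neqAle -val_eqE/= andbC eq_sym.
      by case: eqVneq => //; rewrite andbF.
    rewrite cE.
    rewrite [(normal_prob _ _ D1 * _)%E]muleC.
    by [].
  apply/seteqP; split => w /=.
    move=> [[Aw Cw] [Dw1 Dw2]]; split=> //; split => // j kj; rewrite /C'.
    case: eqVneq => [->//|jk]; apply: Cw.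
    by rewrite ltn_neqAle kj andbT eq_sym.
  move=> [Aw [Dw Cw]]; split; last first.
    by split => //; have := Cw ik (leqnn k); rewrite /C' eqxx.
  split => // j kj; have := Cw j (ltnW kj); rewrite /C'.
  by case: eqVneq => // jk; move: kj; rewrite jk ltnn.
Qed.

Section two_groups_marginals.
Context {R : realType} {d : measure_display} {Om : measurableType d}.
Context (P : probability Om R) {m n : nat} (p sigma : R).
Context (nu : probability (measurableTypeR R) R).
Context (mu : 'I_m -> {RV P >-> R}) (X : 'I_n -> 'I_m -> {RV P >-> R}).
Hypothesis model : two_groups_model p sigma nu mu X.

Lemma effect_marginal (i : 'I_m) (A : set R) : measurable A ->
  P (mu i @^-1` A) = effect_law p nu A.
Proof.
move=> mA; pose A' j := if j == i then A else setT.
have := model.1 A'; rewrite (_ : [set w | _] = mu i @^-1` A); last first.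
  apply/seteqP; split => w /=; first by move/(_ i); rewrite /A' eqxx.
  by move=> Aw j; rewrite /A'; case: eqVneq => [->|].
move=> ->; last by move=> j; rewrite /A'; case: ifP.
rewrite (bigD1 i)//= /A' eqxx big1 ?mule1// => j /negbTE ->.
rewrite /effect_law diracT probability_setT !mule1 -EFinD.
by rewrite subrK.
Qed.

Lemma one_test_law (i : 'I_m) (A : set R) (B : 'I_n -> set R) :
  measurable A -> (forall j, measurable (B j)) ->
  P [set w | A (mu i w) /\ forall j, B j (X j i w)]
  = (\int[P]_(w in mu i @^-1` A)
       \prod_(j < n) normal_prob (mu i w) sigma (B j))%E.
Proof.
move=> mA mB; pose A' k := if k == i then A else setT.
pose B' j k := if k == i then B j else setT.
have mA' k : measurable (A' k) by rewrite /A'; case: ifP.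
have mB' j k : measurable (B' j k).
  by rewrite /B'; case: ifP => _; [exact: mB|].
have := model.2 A' B' mA' mB'.
rewrite (_ : [set w | _] = mu i @^-1` A `&` [set w | forall j, B j (X j i w)]);
  last first.
  apply/seteqP; split => w /=.
    move=> [Aw Bw]; split; first by have := Aw i; rewrite /A' eqxx.
    by move=> j; have := Bw j i; rewrite /B' eqxx.
  move=> [Aw Bw]; split; first by move=> k; rewrite /A'; case: eqVneq => [->|].
  by move=> j k; rewrite /B'; case: eqVneq => [->|].
rewrite [X in (\int[_]_(_ in X) _)%E](_ : _ = mu i @^-1` A); last first.
  apply/seteqP; split => w /=; first by move/(_ i); rewrite /A' eqxx.
  by move=> Aw k; rewrite /A'; case: eqVneq => [->|].
move=> ->; apply: eq_integral => w _.
rewrite (bigD1 i)//= [X in (_ * X)%E]big1 ?mule1; last first.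
  by move=> k /negbTE ki; apply: big1 => j _; rewrite /B' ki probability_setT.
by apply: eq_bigr => j _; rewrite /B' eqxx.
Qed.

Hypothesis sigma_gt0 : 0 < sigma.
Hypothesis n_gt0 : (0 < n)%N.

(** The sum of all observations is normal with mean [n * mu i] and standard
    deviation [sqrt n * sigma]; dividing by [n] rescales both. *)
Lemma sample_mean_law (i : 'I_m) (A B : set R) :
  measurable A -> measurable B ->
  P [set w | A (mu i w) /\ B (sample_mean X i w)]
  = (\int[P]_(w in mu i @^-1` A)
       normal_prob (mu i w) (sigma / Num.sqrt n%:R)%R B)%E.
Proof.
move=> mA mB.
have n0 : 0 < n%:R :> R by rewrite ltr0n.
pose B' : set R := (fun s => n%:R^-1 * s + 0) @^-1` B.
have mB' : measurable B'.
  rewrite /B' -[X in measurable X]setTI.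
  suff : measurable_fun setT (fun s : R => n%:R^-1 * s + 0 : R) by apply.
  by apply: measurable_funD => //; exact: measurable_funM.
have := @partial_sum_law R d Om P n sigma (mu i) (X ^~ i) sigma_gt0
  (@one_test_law i) n _ A B' (fun=> setT) mA mB' (fun=> measurableT).
rewrite n_gt0 leqnn => /(_ isT).
rewrite (_ : [set w | _] = [set w | A (mu i w) /\ B (sample_mean X i w)]).
  move=> ->; apply: eq_integral => w _.
  rewrite big_pred0 ?mul1e; last by move=> j; rewrite leqNgt ltn_ord.
  rewrite normal_prob_affine ?invr_gt0// ?mulr_gt0 ?sqrtr_gt0//.
  rewrite mulKf ?gt_eqF// addr0 mulrA [sigma / _]mulrC.
  rewrite -[X in X^-1 * _ * _](sqr_sqrtr (ltW n0)) expr2 invfM mulfVK//.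
  by rewrite gt_eqF// sqrtr_gt0.
have sE w : \sum_(j < n | (j < n)%N) X j i w = \sum_(j < n) X j i w.
  by apply: eq_bigl => j; rewrite ltn_ord.
apply/seteqP; split => w /=; rewrite /B' /= sE /sample_mean addr0.
  by move=> [? []].
by move=> [? ?].
Qed.

Hypothesis nu0 : nu [set (0 : R)] = 0%E.
Hypothesis p01 : 0 < p < 1.

(** Since [nu] has no atom at 0, an effect that vanishes comes from the Dirac
    component of the effect law. *)
Lemma prob_null_and (i : 'I_m) (B : set R) : measurable B ->
  P [set w | mu i w = 0 /\ B (sample_mean X i w)]
  = ((1 - p)%:E * normal_prob 0%R (sigma / Num.sqrt n%:R)%R B)%E.
Proof.
move=> mB.
have m0 : measurable [set (0 : R)] by exact: measurable_set1.
rewrite (@sample_mean_law i [set (0 : R)] B m0 mB).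
have c_eq : {in mu i @^-1` [set (0 : R)], (fun w => normal_prob (mu i w) (sigma / Num.sqrt n%:R) B)
    =1 cst (normal_prob 0 (sigma / Num.sqrt n%:R) B : \bar R)}.
  by move=> w; rewrite inE /= => ->.
rewrite (eq_integral _ _ c_eq).
move: (normal_prob 0 _ B) => N0.
rewrite integral_cst; last first.
  by rewrite -[X in measurable X]setTI; exact: measurable_funP.
rewrite muleC; congr (_ * _)%E; apply: (etrans (effect_marginal i m0)).
rewrite /effect_law diracE mem_set// mule1.
by rewrite nu0 mule0 adde0.
Qed.

(** Away from 0 the effect law is [p] times [nu]. *)
Lemma prob_nonnull_and (i : 'I_m) (B : set R) : measurable B ->
  P [set w | mu i w <> 0 /\ B (sample_mean X i w)]
  = (p%:E * \int[nu]_u normal_prob u (sigma / Num.sqrt n%:R)%R B)%E.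
Proof.
move=> mB; set s := sigma / Num.sqrt n%:R.
have s0 : s != 0 by rewrite gt_eqF// divr_gt0// sqrtr_gt0 ltr0n.
pose N0 : set R := ~` [set 0].
have m0 : measurable N0 by apply: measurableC; exact: measurable_set1.
rewrite (@sample_mean_law i N0 B m0 mB) -/s.
have mN : measurable_fun setT (fun u => normal_prob u s B : \bar R).
  exact: measurable_normal_prob.
have mND : measurable_fun N0 (fun u => normal_prob u s B : \bar R).
  exact: measurable_funTS.
have p0 : 0 <= p by case/andP: p01 => /ltW.
have mmu : measurable_fun setT (mu i : Om -> measurableTypeR R).
  exact: (@measurable_funP _ _ _ _ setT (mu i)).
pose law : {measure set (measurableTypeR R) -> \bar R} :=
  pushforward P (mu i : Om -> measurableTypeR R).
transitivity (\int[law mmu]_(u in N0) normal_prob u s B)%E.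
  by rewrite [RHS](@ge0_integral_pushforward _ _ Om (measurableTypeR R) R (mu i) mmu P N0 (fun u => normal_prob u s B)).
transitivity (\int[mscale (NngNum p0) nu]_(u in N0) normal_prob u s B)%E.
  apply: (@eq_measure_integral _ _ _ _ (mscale (NngNum p0) nu) (law mmu)) => A mA A0.
  rewrite /pushforward; apply: (etrans (effect_marginal i mA)).
  rewrite /effect_law diracE memNset; last by move/A0; exact.
  by rewrite mule0 add0e.
rewrite ge0_integral_mscale//.
congr (_ * _)%E.
have m1 : measurable ([set 0] : set R) by exact: measurable_set1.
rewrite -[in RHS](setUv ([set 0] : set R)) ge0_integral_setU//; last 2 first.
- by rewrite setUv.
- by apply/disj_setPS => x [].
rewrite [X in _ = (X + _)%E]null_set_integral ?add0e//.
exact: measurable_funTS.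
Qed.

End two_groups_marginals.

(** * The risk of an interval rule *)

Lemma expectation_card {R : realType} {d} {Om : measurableType d}
    (P : probability Om R) (m : nat) (b : 'I_m -> Om -> bool) :
  (forall i, measurable [set w | b i w]) ->
  ('E_P[fun w => (#|[pred i | b i w]|)%:R] = \sum_(i < m) P [set w | b i w])%E.
Proof.
move=> mb; rewrite unlock.
transitivity (\int[P]_w (\sum_(i < m) (\1_[set w | b i w] w)%:E))%E.
  apply: eq_integral => w _; rewrite sumEFin; congr EFin.
  rewrite -sum1_card natr_sum big_mkcond/=; apply: eq_bigr => i _.
  rewrite inE indicE (_ : (w \in _) = b i w); first by case: (b i w).
  by apply/idP/idP => [/set_mem//|?]; exact: mem_set.
rewrite ge0_integral_sum//.
- apply: eq_bigr => i _; rewrite integral_indic ?setIT//; exact: mb.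
- by move=> i; apply/measurable_EFinP; apply: measurable_indic; exact: mb.
Qed.

(** Error probabilities of the test that accepts when the sample mean lies in
    the open interval from [x] to [y]; [s] is the standard deviation of the
    sample mean. *)
Definition type1_error {R : realType} (s x y : R) : R :=
  fine (normal_prob 0 s (~` `]x, y[%classic)).

Definition type2_error {R : realType} (nu : probability (measurableTypeR R) R)
    (s x y : R) : R :=
  fine (\int[nu]_u normal_prob u s `]x, y[%classic)%E.

Lemma type2_fin_num {R : realType} (nu : probability (measurableTypeR R) R)
    (s x y : R) : s != 0 ->
  (\int[nu]_u normal_prob u s `]x, y[%classic)%E \is a fin_num.
Proof.
move=> s0; have mxy : measurable (`]x, y[%classic : set R) by [].
rewrite ge0_fin_numE; last by apply: integral_ge0 => u _; exact: measure_ge0.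
apply: (@le_lt_trans _ _ (\int[nu]_u cst 1 u)%E); last first.
  rewrite integral_cst// mul1e.
  exact: le_lt_trans (probability_le1 nu measurableT) (ltry 1).
apply: ge0_le_integral => //.
- exact: measurable_normal_prob.
- by move=> u _; exact: probability_le1.
Qed.

(** Linearity of the expectation: all tests contribute equally. *)
Lemma risk_interval_rule {R : realType} {d} {Om : measurableType d}
    (P : probability Om R) (m n : nat) (p sigma delta0 deltaA : R)
    (nu : probability (measurableTypeR R) R)
    (mu : 'I_m -> {RV P >-> R}) (X : 'I_n -> 'I_m -> {RV P >-> R}) (x y : R) :
  two_groups_model p sigma nu mu X -> 0 < sigma -> (0 < n)%N ->
  nu [set (0 : R)] = 0%E -> 0 < p < 1 ->
  let s := sigma / Num.sqrt n%:R in
  risk P delta0 deltaA mu (interval_rule X x y)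
  = m%:R * (delta0 * (1 - p) * type1_error s x y + deltaA * p * type2_error nu s x y).
Proof.
move=> model s0 n0 nu0 p01 s.
have mI : measurable (`]x, y[%classic : set R) by [].
have mIC : measurable (~` `]x, y[%classic : set R) by exact: measurableC.
have s1 : s != 0 by rewrite gt_eqF// divr_gt0// sqrtr_gt0 ltr0n.
have m0 : measurable ([set 0] : set R) by exact: measurable_set1.
have mmu i : measurable_fun setT (mu i) by exact: measurable_funP.
have mmean i : measurable_fun setT (sample_mean X i).
  apply: measurable_funM => //; apply: measurable_sum => j.
  exact: measurable_funP.
have rejE i : [set w | (mu i w == 0) && interval_rule X x y i w]
    = [set w | mu i w = 0 /\ (~` `]x, y[%classic) (sample_mean X i w)].
  apply/seteqP; split => w /=; rewrite /interval_rule in_itv/=.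
    by move=> /andP[/eqP-> /negP].
  by move=> [-> /negP ->]; rewrite eqxx.
have accE i : [set w | (mu i w != 0) && ~~ interval_rule X x y i w]
    = [set w | mu i w <> 0 /\ `]x, y[%classic (sample_mean X i w)].
  apply/seteqP; split => w /=; rewrite /interval_rule negbK in_itv/=.
    by move=> /andP[/eqP ? ?].
  by move=> [/eqP -> ->].
rewrite /risk /false_rejections /false_nonrejections.
pose rej i w := (mu i w == 0) && interval_rule X x y i w.
pose acc i w := (mu i w != 0) && ~~ interval_rule X x y i w.
have mrej i : measurable [set w | rej i w].
  rewrite rejE (_ : [set w | _] =
    mu i @^-1` [set 0] `&` sample_mean X i @^-1` (~` `]x, y[%classic))//.
  by apply: measurableI; rewrite -[X in measurable X]setTI; [exact: mmu|exact: mmean].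
have macc i : measurable [set w | acc i w].
  rewrite accE (_ : [set w | _] =
    mu i @^-1` (~` [set 0]) `&` sample_mean X i @^-1` `]x, y[%classic)//.
  apply: measurableI; rewrite -[X in measurable X]setTI; last exact: mmean.
  by apply: mmu => //; exact: measurableC.
rewrite (expectation_card P mrej) (expectation_card P macc).
have prej i : P [set w | rej i w] = ((1 - p)%:E * normal_prob 0 s (~` `]x, y[%classic))%E.
  by rewrite rejE; exact: (prob_null_and model s0 n0 nu0 _ mIC).
have pacc i : P [set w | acc i w]
    = (p%:E * \int[nu]_u normal_prob u s `]x, y[%classic)%E.
  by rewrite accE; exact: (prob_nonnull_and model s0 n0 nu0 p01 _ mI).
rewrite (eq_bigr _ (fun i _ => prej i)) (eq_bigr _ (fun i _ => pacc i)).
have f1 : normal_prob 0 s (~` `]x, y[%classic) = (type1_error s x y)%:E.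
  by rewrite /type1_error fineK// fin_num_measure.
have f2 : (\int[nu]_u normal_prob u s `]x, y[%classic)%E = (type2_error nu s x y)%:E.
  by rewrite /type2_error fineK// type2_fin_num.
rewrite f1 f2 -!EFinM !sumEFin/= !sumr_const !card_ord.
by ring.
Qed.

(** * Optimality of the oracle interval *)

(** Weighted sum of the tangent inequalities at the convex combination, in
    which the linear terms cancel. *)
Lemma expR_convex_comb {R : realType} (l x y : R) : 0 <= l <= 1 ->
  expR (l * x + (1 - l) * y) <= l * expR x + (1 - l) * expR y.
Proof.
move=> /andP[l0 l1]; set c := l * x + (1 - l) * y.
have tangent z : expR c * (1 + (z - c)) <= expR z.
  have -> : expR z = expR c * expR (z - c) by rewrite -expRD subrKC.
  by rewrite ler_pM2l ?expR_gt0// expR_ge1Dx.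
have -> : expR c = l * (expR c * (1 + (x - c))) + (1 - l) * (expR c * (1 + (y - c))).
  by rewrite /c; ring.
by rewrite lerD// ler_wpM2l// subr_ge0.
Qed.

Section likelihood_ratio.
Context {R : realType} (n : nat) (sigma : R) (nu : probability (measurableTypeR R) R).
Hypothesis sigma_gt0 : 0 < sigma.
Hypothesis n_gt0 : (0 < n)%N.

(** Likelihood ratio of the effect [u] against the effect 0 when the sample
    mean is [t]. *)
Definition normal_lr (t u : R) : R :=
  expR (n%:R * (t * (u / sigma ^+ 2) - u ^+ 2 / (2 * sigma ^+ 2))).

Lemma normal_lrE (t u : R) :
  normal_pdf u (sigma / Num.sqrt n%:R) t
  = normal_pdf 0 (sigma / Num.sqrt n%:R) t * normal_lr t u.
Proof.
have n0 : 0 < n%:R :> R by rewrite ltr0n.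
have s0 : sigma / Num.sqrt n%:R != 0 by rewrite gt_eqF// divr_gt0// sqrtr_gt0.
rewrite !normal_pdfE// -mulrA -expRD; congr (_ * expR _).
rewrite exprMn exprVn sqr_sqrtr ?ltW//.
by field; rewrite ?gt_eqF.
Qed.

Lemma measurable_normal_lr : measurable_fun setT
  (fun z : measurableTypeR R * measurableTypeR R => normal_lr z.1 z.2).
Proof.
apply: measurableT_comp => //; apply: measurable_funM => //.
apply: measurable_funB; apply: measurable_funM => //.
  by apply: measurable_funM => //; exact: measurable_snd.
by apply: measurable_funX; exact: measurable_snd.
Qed.

Lemma measurable_normal_lr2 (t : R) :
  measurable_fun setT (fun u : measurableTypeR R => normal_lr t u).
Proof.
exact: (measurableT_comp measurable_normal_lr (pair1_measurable t)).
Qed.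

(** The exponent is quadratic in [u] with maximum at [u = t]; this makes the
    average over the effects finite. *)
Lemma normal_lr_ub (t u : R) :
  normal_lr t u <= expR (n%:R * (t ^+ 2 / (2 * sigma ^+ 2))).
Proof.
rewrite ler_expR ler_wpM2l// -subr_ge0.
have -> : t ^+ 2 / (2 * sigma ^+ 2)
    - (t * (u / sigma ^+ 2) - u ^+ 2 / (2 * sigma ^+ 2))
    = ((t - u) / sigma) ^+ 2 / 2.
  by field; rewrite gt_eqF.
by rewrite divr_ge0// sqr_ge0.
Qed.

Definition mean_lr (t : R) : R := fine (\int[nu]_u (normal_lr t u)%:E)%E.

Lemma mean_lrE (t : R) : (\int[nu]_u (normal_lr t u)%:E)%E = (mean_lr t)%:E.
Proof.
rewrite /mean_lr fineK// ge0_fin_numE; last first.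
  by apply: integral_ge0 => u _; rewrite lee_fin expR_ge0.
apply: (@le_lt_trans _ _
  (\int[nu]_u cst (expR (n%:R * (t ^+ 2 / (2 * sigma ^+ 2))))%:E u)%E).
  apply: ge0_le_integral => //.
  - by move=> u _; rewrite lee_fin expR_ge0.
  - by apply/measurable_EFinP; exact: measurable_normal_lr2.
  - by move=> u _; rewrite lee_fin normal_lr_ub.
rewrite integral_cst//; apply: lte_mul_pinfty; rewrite ?lee_fin ?expR_ge0//.
exact: le_lt_trans (probability_le1 nu measurableT) (ltry 1).
Qed.

Lemma mean_lr_convex (l x y : R) : 0 <= l <= 1 ->
  mean_lr (l * x + (1 - l) * y) <= l * mean_lr x + (1 - l) * mean_lr y.
Proof.
move=> l01; have /andP[l0 l1] := l01.
have l1' : 0 <= 1 - l by rewrite subr_ge0.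
rewrite -lee_fin EFinD !EFinM -!mean_lrE.
rewrite -!ge0_integralZl_EFin//; try by [move=> u _; rewrite lee_fin expR_ge0
  | apply/measurable_EFinP; exact: measurable_normal_lr2].
have mZ k z : measurable_fun setT (fun u : measurableTypeR R => (k%:E * (normal_lr z u)%:E)%E).
  apply/measurable_EFinP; apply: measurable_funM => //.
  exact: measurable_normal_lr2.
rewrite -ge0_integralD//; try by [exact: mZ
  | move=> u _; rewrite mule_ge0// lee_fin expR_ge0].
apply: ge0_le_integral => //.
- by move=> u _; rewrite lee_fin expR_ge0.
- by apply/measurable_EFinP; exact: measurable_normal_lr2.
- by apply: emeasurable_funD; exact: mZ.
move=> u _; rewrite -!EFinM -EFinD lee_fin.
apply: le_trans (expR_convex_comb _ _ l01).
rewrite /normal_lr ler_expR le_eqVlt; apply/orP; left; apply/eqP; ring.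
Qed.

(** A convex function is at most [c] between two points of the level set [c]
    and, by the next lemma, at least [c] elsewhere. *)
Lemma mean_lr_inside (a b t : R) : mean_lr a = mean_lr b -> a < b ->
  a < t < b -> mean_lr t <= mean_lr a.
Proof.
move=> gab ab /andP[at_ tb].
have ba : 0 < b - a by rewrite subr_gt0.
pose l := (b - t) / (b - a).
have l01 : 0 <= l <= 1.
  apply/andP; split; first by rewrite divr_ge0// ?subr_ge0 ltW.
  by rewrite /l ler_pdivrMr// mul1r lerD2l lerN2 ltW.
have -> : t = l * a + (1 - l) * b by rewrite /l; field; rewrite gt_eqF.
apply: le_trans (mean_lr_convex _ _ l01) _.
by rewrite -gab le_eqVlt; apply/orP; left; apply/eqP; ring.
Qed.

Lemma mean_lr_outside (a b t : R) : mean_lr a = mean_lr b -> a < b ->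
  ~~ (a < t < b) -> mean_lr a <= mean_lr t.
Proof.
move=> gab ab; rewrite negb_and -!leNgt => /orP[ta|bt].
  have bt : 0 < b - t by rewrite subr_gt0 (le_lt_trans ta).
  pose l := (b - a) / (b - t).
  have l0 : 0 < l by rewrite divr_gt0// subr_gt0.
  have l01 : 0 <= l <= 1.
    by rewrite (ltW l0)/= /l ler_pdivrMr// mul1r lerD2l lerN2.
  have E : a = l * t + (1 - l) * b by rewrite /l; field; rewrite gt_eqF.
  have := mean_lr_convex t b l01; rewrite -E -gab => H.
  have : l * mean_lr a <= l * mean_lr t by lra.
  by rewrite ler_pM2l.
have ta : 0 < t - a by rewrite subr_gt0 (lt_le_trans ab).
pose l := (b - a) / (t - a).
have l0 : 0 < l by rewrite divr_gt0// subr_gt0.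
have l01 : 0 <= l <= 1 by rewrite (ltW l0)/= /l ler_pdivrMr// mul1r lerD2r.
have E : b = l * t + (1 - l) * a by rewrite /l; field; rewrite gt_eqF.
have := mean_lr_convex t a l01; rewrite -E -gab => H.
have : l * mean_lr a <= l * mean_lr t by lra.
by rewrite ler_pM2l.
Qed.

End likelihood_ratio.

Section bayes_cost.
Context {R : realType} (n : nat) (sigma : R) (nu : probability (measurableTypeR R) R).
Hypothesis sigma_gt0 : 0 < sigma.
Hypothesis n_gt0 : (0 < n)%N.
Let s := sigma / Num.sqrt n%:R.
Let g := mean_lr n sigma nu.

Lemma measurable_mean_lr : measurable_fun setT (g : measurableTypeR R -> R).
Proof.
apply/measurable_EFinP.
pose F (z : measurableTypeR R * measurableTypeR R) : \bar R :=
  (normal_lr n sigma z.1 z.2)%:E.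
rewrite (_ : _ \o _ = fubini_F nu F).
  apply: measurable_fun_fubini_tonelli_F.
    by apply/measurable_EFinP; exact: measurable_normal_lr.
  by move=> z; rewrite lee_fin expR_ge0.
by apply/funext => t; rewrite /= /g -mean_lrE.
Qed.

Let s_gt0 : 0 < s.
Proof. by rewrite divr_gt0// sqrtr_gt0 ltr0n. Qed.

(** Tonelli's theorem: under the law of the nonzero effects, the sample mean
    has density [mean_lr] with respect to its null law. *)
Lemma type2_lr (x y : R) : (type2_error nu s x y)%:E
  = (\int[lebesgue_measure]_t
      (normal_pdf 0 s t * g t * \1_(`]x, y[%classic) t)%:E)%E.
Proof.
rewrite /type2_error fineK; last by rewrite type2_fin_num ?gt_eqF.
pose F (z : measurableTypeR R * measurableTypeR R) : \bar R :=
  (normal_pdf z.1 s z.2 * \1_(`]x, y[%classic) z.2)%:E.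
have mI : measurable_fun setT (\1_(`]x, y[%classic) : measurableTypeR R -> R).
  by apply: measurable_indic.
have mF : measurable_fun setT F.
  apply/measurable_EFinP/measurable_funM; last exact: measurableT_comp.
  by apply: measurable_normal_pdf_pair; rewrite ?gt_eqF.
have F0 z : (0 <= F z)%E by rewrite lee_fin mulr_ge0 ?normal_pdf_ge0.
transitivity (\int[nu]_u \int[lebesgue_measure]_t F (u, t))%E.
  apply: eq_integral => u _; rewrite /normal_prob [LHS]integral_mkcond.
  apply: eq_integral => t _; rewrite patchE /F /= indicE.
  by case: ifP => _; rewrite ?mulr1 ?mulr0.
rewrite (fubini_tonelli F mF F0); apply: eq_integral => t _.
transitivity (\int[nu]_u ((normal_pdf 0 s t * \1_(`]x, y[%classic) t)%:E
    * (normal_lr n sigma t u)%:E))%E.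
  by apply: eq_integral => u _; rewrite /F /= /s normal_lrE// -EFinM mulrAC.
rewrite ge0_integralZl_EFin//.
- by rewrite mean_lrE// -EFinM mulrAC.
- by move=> u _; rewrite lee_fin expR_ge0.
- by apply/measurable_EFinP; exact: measurable_normal_lr2.
- by rewrite mulr_ge0 ?normal_pdf_ge0.
Qed.

(** The cost of a decision region is an integral whose integrand at [t]
    depends only on whether [t] is accepted. *)
Lemma bayes_costE (c0 c1 x y : R) : 0 <= c0 -> 0 <= c1 ->
  (c0 * type1_error s x y + c1 * type2_error nu s x y)%:E
  = (\int[lebesgue_measure]_t (normal_pdf 0 s t
      * (if (x < t < y) then c1 * g t else c0))%:E)%E.
Proof.
move=> c00 c10.
have mI : measurable (`]x, y[%classic : set R) by [].
have mI1 : measurable_fun setT (\1_(`]x, y[%classic) : measurableTypeR R -> R).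
  by apply: measurable_indic.
have mI2 : measurable_fun setT (\1_(~` `]x, y[%classic) : measurableTypeR R -> R).
  by apply: measurable_indic; exact: measurableC.
have mp : measurable_fun setT (normal_pdf 0 s : measurableTypeR R -> R).
  exact: measurable_normal_pdf.
have g0 t : 0 <= g t.
  rewrite -lee_fin /g -mean_lrE//.
  by apply: integral_ge0 => u _; rewrite lee_fin expR_ge0.
have t1E : (type1_error s x y)%:E = (\int[lebesgue_measure]_t
    (normal_pdf 0 s t * \1_(~` `]x, y[%classic) t)%:E)%E.
  rewrite /type1_error fineK; last by rewrite fin_num_measure//; exact: measurableC.
  rewrite /normal_prob [LHS]integral_mkcond.
  apply: eq_integral => t _; rewrite patchE /= indicE.
  by case: ifP => _; rewrite ?mulr1 ?mulr0.
rewrite EFinD !EFinM t1E type2_lr.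
have m1 : measurable_fun setT (fun t : measurableTypeR R =>
    (normal_pdf 0 s t * \1_(~` `]x, y[%classic) t)%:E : \bar R).
  by apply/measurable_EFinP; exact: measurable_funM.
have m2 : measurable_fun setT (fun t : measurableTypeR R =>
    (normal_pdf 0 s t * g t * \1_(`]x, y[%classic) t)%:E : \bar R).
  apply/measurable_EFinP; apply: measurable_funM => //.
  by apply: measurable_funM => //; exact: measurable_mean_lr.
rewrite -!ge0_integralZl_EFin//; last 2 first.
- by move=> t _; rewrite lee_fin !mulr_ge0 ?normal_pdf_ge0.
- by move=> t _; rewrite lee_fin !mulr_ge0 ?normal_pdf_ge0.
rewrite -ge0_integralD//; last 4 first.
- by move=> t _; rewrite -EFinM lee_fin !mulr_ge0 ?normal_pdf_ge0.
- exact: measurable_funeM.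
- by move=> t _; rewrite -EFinM lee_fin !mulr_ge0 ?normal_pdf_ge0.
- exact: measurable_funeM.
apply: eq_integral => t _; rewrite -!EFinM -EFinD; congr EFin.
rewrite !indicE in_setC mem_setE /= in_itv/=.
by case: ifP => _ /=; ring.
Qed.

(** By convexity of [mean_lr], the oracle accepts exactly the points [t] where
    acceptance is the cheaper decision, so its integrand is pointwise minimal. *)
Lemma oracle_interval_optimal (p delta0 deltaA a b x y : R) :
  0 < p < 1 -> 0 < delta0 -> 0 < deltaA ->
  oracle_thresholds n p delta0 deltaA sigma nu a b ->
  delta0 * (1 - p) * type1_error s a b + deltaA * p * type2_error nu s a b
  <= delta0 * (1 - p) * type1_error s x y + deltaA * p * type2_error nu s x y.
Proof.
move=> /andP[p0 p1] d0 dA [a0 b0 ea eb].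
have c00 : 0 <= delta0 * (1 - p) by apply: mulr_ge0; rewrite ?subr_ge0 ltW.
have c10 : 0 < deltaA * p by rewrite mulr_gt0.
have solE z : oracle_equation n p delta0 deltaA sigma nu z ->
    delta0 * (1 - p) = deltaA * p * g z.
  rewrite /oracle_equation; have := mean_lrE n nu sigma_gt0 z.
  rewrite /normal_lr => ->; rewrite -EFinM => -[].
  by rewrite mulrC => ->; rewrite [p * _]mulrC.
have ga := solE _ ea; have gb := solE _ eb.
clear ea eb solE.
have gab : g a = g b.
  by apply: (mulfI (lt0r_neq0 c10)); rewrite -ga -gb.
have ab : a < b by exact: lt_trans b0.
have g0 t : 0 <= g t.
  rewrite -lee_fin /g -mean_lrE//.
  by apply: integral_ge0 => u _; rewrite lee_fin expR_ge0.
have mw u w : measurable_fun setT (fun t : measurableTypeR R =>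
    (normal_pdf 0 s t * (if (u < t < w)
       then deltaA * p * g t else delta0 * (1 - p)))%:E : \bar R).
  apply/measurable_EFinP; apply: measurable_funM; first exact: measurable_normal_pdf.
  apply: measurable_fun_ifT.
  - rewrite (_ : (fun t => _) = (fun t => (u < t) && (t < w)))//.
    by apply: measurable_and; apply: measurable_fun_ltr.
  - by apply: measurable_funM => //; exact: measurable_mean_lr.
  - exact: measurable_cst.
have Ea := bayes_costE a b c00 (ltW c10).
have Ex := bayes_costE x y c00 (ltW c10).
rewrite -lee_fin [leLHS]Ea [leRHS]Ex.
apply: ge0_le_integral => //.
- move=> t _; rewrite lee_fin mulr_ge0 ?normal_pdf_ge0//.
  by case: ifP => _ //; rewrite mulr_ge0// ltW.
move=> t _; rewrite lee_fin ler_wpM2l ?normal_pdf_ge0//.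
have inside : a < t < b -> deltaA * p * g t <= delta0 * (1 - p).
  by move=> atb; rewrite ga ler_pM2l//; exact: (mean_lr_inside sigma_gt0 gab ab atb).
have outside : ~~ (a < t < b) -> delta0 * (1 - p) <= deltaA * p * g t.
  by move=> atb; rewrite ga ler_pM2l//; exact: (mean_lr_outside sigma_gt0 gab ab atb).
case: ifPn => [atb|atb]; case: ifPn => // _; [exact: inside|exact: outside].
Qed.

End bayes_cost.

(** * Normal tails *)

Lemma ge0_integral_opp {R : realType} (f : R -> \bar R) :
  measurable_fun setT f -> (forall x, 0 <= f x)%E ->
  (\int[lebesgue_measure]_x f (- (x : R))%R = \int[lebesgue_measure]_x f x)%E.
Proof.
move=> mf f0.
pose phi : measurableTypeR R -> measurableTypeR R := fun x => - x.
have mphi : measurable_fun setT phi by exact: oppr_measurable.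
rewrite -[LHS](@ge0_integral_pushforward _ _ _ _ R phi mphi lebesgue_measure setT f)//.
apply: eq_measure_integral => A mA _.
exact: lebesgue_measureN.
Qed.

Lemma normal_prob_opp {R : realType} (m s : R) (B : set R) :
  s != 0 -> measurable B ->
  normal_prob m s ((fun y => - y) @^-1` B) = normal_prob (- m) s B.
Proof.
move=> s0 mB; rewrite /normal_prob.
have pdfE x : normal_pdf m s x = normal_pdf (- m) s (- x).
  rewrite !normal_pdfE// /normal_fun opprK.
  by rewrite [- x + m]addrC -[m - x]opprB sqrrN.
set f := fun y : R => (normal_pdf (- m) s y * \1_B y)%:E.
rewrite [LHS]integral_mkcond /=.
transitivity (\int[lebesgue_measure]_x f (- (x : R))%R)%E.
  apply: eq_integral => x _; rewrite patchE /f /= indicE -[x \in _]/(- x \in B).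
  by case: ifP => _; rewrite ?mulr1 ?mulr0// pdfE.
rewrite ge0_integral_opp//; last 2 first.
- apply/measurable_EFinP; apply: measurable_funM => //.
  exact: measurable_normal_pdf.
- by move=> x; rewrite lee_fin mulr_ge0// ?normal_pdf_ge0.
rewrite [RHS]integral_mkcond /=; apply: eq_integral => x _.
by rewrite patchE /f indicE; case: ifP => _; rewrite ?mulr1 ?mulr0.
Qed.

Definition normal_tail {R : realType} (x : R) : R :=
  fine (normal_prob 0 1 `[x, +oo[%classic).

Section normal_tail.
Context {R : realType}.
Implicit Types u s x y : R.
Local Notation Q := (@normal_tail R).

Lemma normal_tailE x : normal_prob 0 1 `[x, +oo[%classic = (Q x)%:E.
Proof. by rewrite /normal_tail fineK// fin_num_measure. Qed.

Lemma normal_tail_ge0 x : 0 <= Q x.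
Proof. by rewrite fine_ge0. Qed.

Lemma normal_tail_le x y : x <= y -> Q y <= Q x.
Proof.
move=> xy; rewrite -lee_fin -!normal_tailE; apply: le_measure; rewrite ?inE//.
by move=> z /=; rewrite !in_itv/= !andbT; exact: le_trans.
Qed.

Lemma normal_upper_tail u s y : 0 < s ->
  normal_prob u s `[y, +oo[%classic = (Q ((y - u) / s))%:E.
Proof.
move=> s0; rewrite -normal_tailE.
have -> : u = s * 0 + u by rewrite mulr0 add0r.
rewrite -[s in normal_prob _ s]mulr1 -normal_prob_affine// mulr0 add0r.
congr (normal_prob _ _ _); apply/seteqP; split => z /=; rewrite !in_itv/= !andbT.
  by rewrite ler_pdivrMr// lerBlDr mulrC.
by rewrite ler_pdivrMr// lerBlDr mulrC.
Qed.

Lemma normal_lower_tail u s x : 0 < s ->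
  normal_prob u s `]-oo, x]%classic = (Q ((u - x) / s))%:E.
Proof.
move=> s0.
have -> : `]-oo, x]%classic = (fun y : R => - y) @^-1` `[- x, +oo[%classic.
  by apply/seteqP; split => z /=; rewrite !in_itv/= andbT lerN2.
rewrite normal_prob_opp ?gt_eqF// normal_upper_tail//.
by rewrite opprK addrC.
Qed.

Lemma normal_outside u s x y : 0 < s -> x < y ->
  normal_prob u s (~` `]x, y[%classic)
  = (Q ((u - x) / s) + Q ((y - u) / s))%:E.
Proof.
move=> s0 xy; rewrite EFinD -normal_lower_tail// -normal_upper_tail//.
rewrite -measureU//.
  congr (normal_prob _ _ _); apply/seteqP; split => z /=; rewrite !in_itv/= andbT.
    by move/negP; rewrite negb_and -!leNgt => /orP.
  by move=> zxy; apply/negP; rewrite negb_and -!leNgt; apply/orP.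
apply/seteqP; split => // z /=; rewrite !in_itv/= andbT => -[zx yz].
by have := lt_le_trans xy (le_trans yz zx); rewrite ltxx.
Qed.

Lemma normal_inside u s x y : 0 < s -> x < y ->
  normal_prob u s `]x, y[%classic
  = (1 - (Q ((u - x) / s) + Q ((y - u) / s)))%:E.
Proof.
move=> s0 xy; have := normal_outside u s0 xy.
rewrite probability_setC//=.
have <- : (fine (normal_prob u s `]x, y[%classic))%:E = normal_prob u s `]x, y[%classic.
  by rewrite fineK// fin_num_measure.
by rewrite -EFinB => -[H]; congr EFin; lra.
Qed.

Local Notation k0 := (normal_peak (1 : R)).

Lemma normal_pdf01 x : normal_pdf 0 1 x = k0 * expR (- (x ^+ 2 / 2)).
Proof.
rewrite normal_pdfE ?oner_neq0// /normal_fun subr0 expr1n.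
by rewrite mulNr.
Qed.

(** Mills' inequality.  Since [(x + t)^2 >= x^2 + 2 x t], the shifted normal
    density is dominated by a multiple of the exponential density of rate [x]. *)
Lemma normal_tail_ub x : 0 < x -> Q x <= k0 / x * expR (- (x ^+ 2 / 2)).
Proof.
move=> x0; have k00 : 0 < k0 by rewrite normal_peak_gt0// oner_neq0.
set c := _ * expR _.
have c0 : 0 <= c by rewrite mulr_ge0 ?expR_ge0// divr_ge0// ltW.
rewrite -lee_fin -normal_tailE /normal_prob.
pose f t := (normal_pdf 0 1 t * \1_(`[x, +oo[%classic) t)%:E.
have mI : measurable_fun setT (\1_(`[x, +oo[%classic) : measurableTypeR R -> R).
  by apply: measurable_indic.
have mf : measurable_fun setT (f : measurableTypeR R -> \bar R).
  apply/measurable_EFinP; apply: measurable_funM => //.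
  exact: measurable_normal_pdf.
have f0 t : (0 <= f t)%E by rewrite lee_fin mulr_ge0 ?normal_pdf_ge0.
have -> : (\int[lebesgue_measure]_(t in `[x, +oo[) (normal_pdf 0 1 t)%:E
    = \int[lebesgue_measure]_t f t)%E.
  rewrite [LHS]integral_mkcond; apply: eq_integral => t _.
  by rewrite patchE /f indicE; case: ifP => _; rewrite ?mulr1 ?mulr0.
have := @ge0_integral_affine R 1 x f ltr01 mf f0.
rewrite invr1 mul1e => <-.
rewrite -[leRHS]mule1 -(integral_exponential_pdf x0).
rewrite -ge0_integralZl//; last 2 first.
- by apply/measurable_EFinP; exact: measurable_exponential_pdf.
- by move=> t _; rewrite lee_fin exponential_pdf_ge0// ltW.
apply: ge0_le_integral => //.
- apply: measurableT_comp mf _.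
  by apply: measurable_funD => //; exact: measurable_funM.
- apply: measurable_funeM.
  by apply/measurable_EFinP; exact: measurable_exponential_pdf.
move=> t _; rewrite /f -EFinM lee_fin mul1r indicE.
case: (boolP (_ \in _)) => [|_]; last first.
  by rewrite mulr0 mulr_ge0// exponential_pdf_ge0// ltW.
rewrite inE /= in_itv/= andbT lerDr => t0.
rewrite exponential_pdfE// mulr1 normal_pdf01 /c.
have -> : k0 / x * expR (- (x ^+ 2 / 2)) * (x * expR (- x * t))
    = k0 * expR (- (x ^+ 2 / 2) - x * t).
  by rewrite expRD mulNr; field; rewrite gt_eqF.
rewrite ler_pM2l// ler_expR.
have := sqr_ge0 t; lra.
Qed.

(** On the interval from [x] to [x + 1/x] the exponent [t^2 / 2] exceeds
    [x^2 / 2] by at most [1 + 1/2]. *)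
Lemma normal_tail_lb x : 1 <= x ->
  k0 * expR (- (3 / 2)) / x * expR (- (x ^+ 2 / 2)) <= Q x.
Proof.
move=> x1; have x0 : 0 < x by exact: lt_le_trans x1.
have xi0 : 0 < x^-1 by rewrite invr_gt0.
have xi1 : x^-1 <= 1 by rewrite invf_le1.
have xxi : x * x^-1 = 1 by rewrite divff ?gt_eqF.
have k00 : 0 < k0 by rewrite normal_peak_gt0// oner_neq0.
rewrite -lee_fin -normal_tailE.
set c := k0 * expR (- (3 / 2)) * expR (- (x ^+ 2 / 2)).
have c0 : 0 <= c by rewrite !mulr_ge0 ?expR_ge0// ltW.
apply: (@le_trans _ _ (normal_prob 0 1 `[x, x + x^-1]%classic)); last first.
  apply: le_measure; rewrite ?inE//.
  by move=> z /=; rewrite !in_itv/= andbT => /andP[].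
have -> : k0 * expR (- (3 / 2)) / x * expR (- (x ^+ 2 / 2)) = c * x^-1.
  by rewrite /c; ring.
pose J : set R := `[x, x + x^-1]%classic.
rewrite -/J; have mJ : measurable J by exact: measurable_itv.
have -> : (c * x^-1)%:E = (\int[lebesgue_measure]_(t in J) (c%:E))%E.
  rewrite integral_cst//= /J lebesgue_measure_itv/= lte_fin ltrDl xi0.
  by rewrite -EFinB addrAC subrr add0r.
apply: ge0_le_integral => //.
- apply: measurable_funTS; apply/measurable_EFinP.
  exact: measurable_normal_pdf.
move=> t; rewrite /J /= in_itv/= lee_fin => /andP[xt tx].
rewrite normal_pdf01 /c -mulrA -expRD ler_pM2l// ler_expR.
have t0 : 0 <= t by apply: le_trans xt; exact: ltW.
have : t ^+ 2 <= (x + x^-1) ^+ 2.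
  by rewrite ler_sqr ?nnegrE// addr_ge0// ltW.
have -> : (x + x^-1) ^+ 2 = x ^+ 2 + 2 + x^-1 * x^-1.
  by rewrite sqrrD xxi expr2 -expr2; ring.
have : x^-1 * x^-1 <= 1 by rewrite mulr_ile1// ltW.
lra.
Qed.

End normal_tail.

(** * Bounds on the error probabilities *)

Section error_bounds.
Context {R : realType} (nu : probability (measurableTypeR R) R) (s : R).
Hypothesis s_gt0 : 0 < s.
Local Notation Q := (@normal_tail R).

Definition seg_mass (x y : R) : R := fine (nu `[x, y]%classic).

Lemma seg_massE x y : nu `[x, y]%classic = (seg_mass x y)%:E.
Proof. by rewrite /seg_mass fineK// fin_num_measure. Qed.

Lemma seg_mass_ge0 x y : 0 <= seg_mass x y.
Proof. by rewrite fine_ge0. Qed.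

Lemma seg_mass_le1 x y : seg_mass x y <= 1.
Proof. by rewrite -lee_fin -seg_massE probability_le1. Qed.

Lemma seg_mass_le x y x' y' : x' <= x -> y <= y' -> seg_mass x y <= seg_mass x' y'.
Proof.
move=> xx yy; rewrite -lee_fin -!seg_massE; apply: le_measure; rewrite ?inE//.
by move=> z /=; rewrite !in_itv/= => /andP[xz zy]; rewrite (le_trans xx)// (le_trans zy).
Qed.

Lemma type1E x y : x < y -> type1_error s x y = Q (- x / s) + Q (y / s).
Proof. by move=> xy; rewrite /type1_error normal_outside//= sub0r subr0. Qed.

Lemma type2E x y :
  (type2_error nu s x y)%:E = (\int[nu]_u normal_prob u s `]x, y[%classic)%E.
Proof. by rewrite /type2_error fineK// type2_fin_num ?gt_eqF. Qed.

Lemma type2_ge0 x y : 0 <= type2_error nu s x y.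
Proof. by rewrite -lee_fin type2E; apply: integral_ge0. Qed.

Let measurable_accept x y :
  measurable_fun setT (fun u : measurableTypeR R => normal_prob u s `]x, y[%classic : \bar R).
Proof. by apply: measurable_normal_prob; rewrite ?gt_eqF. Qed.

(** An effect at distance at least [r] from both thresholds is accepted unless
    the noise exceeds [r]. *)
Lemma type2_lb x y r : x < y ->
  seg_mass (x + r) (y - r) * (1 - 2 * Q (r / s)) <= type2_error nu s x y.
Proof.
move=> xy; have [q0|q0] := ltP (1 - 2 * Q (r / s)) 0.
  apply: le_trans (type2_ge0 x y).
  by rewrite mulr_ge0_le0// ?seg_mass_ge0// ltW.
pose A : set R := `[x + r, y - r]%classic.
have mA : measurable A by exact: measurable_itv.
rewrite -lee_fin type2E EFinM -seg_massE -/A.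
have -> : (nu A * (1 - 2 * Q (r / s))%:E
    = \int[nu]_(u in A) (1 - 2 * Q (r / s))%:E)%E.
  by rewrite integral_cst// muleC.
apply: (@le_trans _ _ (\int[nu]_(u in A) normal_prob u s `]x, y[%classic)%E); last first.
  exact: ge0_subset_integral.
apply: ge0_le_integral => //.
- exact: measurable_funTS.
move=> u; rewrite /A /= in_itv/= => /andP[xu uy].
rewrite normal_inside// lee_fin.
have h1 : Q ((u - x) / s) <= Q (r / s).
  by apply: normal_tail_le; rewrite ler_pM2r ?invr_gt0//; lra.
have h2 : Q ((y - u) / s) <= Q (r / s).
  by apply: normal_tail_le; rewrite ler_pM2r ?invr_gt0//; lra.
by lra.
Qed.

(** The effects are split into those within [r] of the interval, the other
    ones in the segment from [- B] to [B], and the rest, which is at distance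
    at least [B'] from the interval.  The intermediate class is needed because
    [Q (r / s)] alone need not be small in comparison with the scale of the
    thresholds; there it is multiplied by a small mass. *)
Lemma type2_ub x y r B B' : x < y -> 0 <= r -> 0 <= B' -> - (B - B') <= x -> y <= B - B' ->
  type2_error nu s x y
  <= seg_mass (x - r) (y + r) + Q (r / s) * seg_mass (- B) B + Q (B' / s).
Proof.
move=> xy r0 B'0 xB yB.
pose A : set R := `[x - r, y + r]%classic.
pose D : set R := `[- B, B]%classic.
have mA : measurable A by exact: measurable_itv.
have mD : measurable D by exact: measurable_itv.
have Q0 z : 0 <= Q z by exact: normal_tail_ge0.
have mi (E : set R) : measurable E ->
    measurable_fun setT (\1_E : measurableTypeR R -> R).
  by move=> mE; apply: measurable_indic.
have accept_left u : (normal_prob u s `]x, y[%classic <= (Q ((u - y) / s))%:E)%E.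
  rewrite -normal_lower_tail//; apply: le_measure; rewrite ?inE//.
  by move=> z /=; rewrite !in_itv/= => /andP[_ /ltW].
have accept_right u : (normal_prob u s `]x, y[%classic <= (Q ((x - u) / s))%:E)%E.
  rewrite -normal_upper_tail//; apply: le_measure; rewrite ?inE//.
  by move=> z /=; rewrite !in_itv/= andbT => /andP[/ltW].
pose h u : R := \1_A u + Q (r / s) * \1_D u + Q (B' / s).
have step : (\int[nu]_u normal_prob u s `]x, y[%classic <= \int[nu]_u (h u)%:E)%E.
  apply: ge0_le_integral => //.
  - apply/measurable_EFinP; apply: measurable_funD => //.
    apply: measurable_funD; first exact: mi.
    by apply: measurable_funM => //; exact: mi.
  move=> u _; rewrite /h !indicE.
  have [uA|uA] := boolP (u \in A).
    apply: (le_trans (probability_le1 _ _)) => //.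
    rewrite lee_fin -addrA lerDl addr_ge0// mulr_ge0//.
  have mono w : r <= w -> Q (w / s) <= Q (r / s).
    by move=> rw; apply: normal_tail_le; rewrite ler_pM2r ?invr_gt0.
  have mono' w : B' <= w -> Q (w / s) <= Q (B' / s).
    by move=> rw; apply: normal_tail_le; rewrite ler_pM2r ?invr_gt0.
  have side w : (normal_prob u s `]x, y[%classic <= (Q (w / s))%:E)%E ->
      r <= w -> (u \notin D -> B' <= w) ->
      (normal_prob u s `]x, y[%classic
       <= (false%:R + Q (r / s) * (u \in D)%:R + Q (B' / s))%:E)%E.
    move=> Hw rw HD; apply: (le_trans Hw); rewrite lee_fin add0r.
    have [uD|uD] := boolP (u \in D).
      by rewrite mulr1 (le_trans (mono _ rw))// lerDl.
    by rewrite mulr0 add0r mono'// HD.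
  have uD' : u \notin D -> u < - B \/ B < u.
    move=> uD; apply/orP; move: uD; apply: contraNT.
    rewrite negb_or -!leNgt => /andP[h1 h2].
    by rewrite inE /D /= in_itv/= h1 h2.
  have [uxr|uxr] := ltP u (x - r).
    apply: (side (x - u)) => //; first by lra.
    by move/uD' => [h1|h1]; lra.
  have yru : y + r < u.
    rewrite ltNge; apply/negP => uyr; move/negP: uA; apply.
    by rewrite inE /A /= in_itv/= uxr uyr.
  apply: (side (u - y)) => //; first by lra.
  by move/uD' => [h1|h1]; lra.
rewrite -lee_fin type2E; apply: (le_trans step).
rewrite !EFinD EFinM -!seg_massE -/A -/D.
have mhA : measurable_fun setT (fun u : measurableTypeR R => (\1_A u)%:E : \bar R).
  by apply/measurable_EFinP; exact: mi.
have mhD : measurable_fun setT (fun u : measurableTypeR R => ((Q (r / s))%:E * (\1_D u)%:E)%E).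
  by apply: measurable_funeM; apply/measurable_EFinP; exact: mi.
under eq_integral do rewrite /h !EFinD EFinM.
rewrite ge0_integralD//; last 3 first.
- by move=> u _; rewrite -EFinM -EFinD lee_fin addr_ge0// mulr_ge0.
- exact: emeasurable_funD.
- by move=> u _; rewrite lee_fin.
rewrite ge0_integralD//; last by move=> u _; rewrite -EFinM lee_fin mulr_ge0.
rewrite ge0_integralZl_EFin//; last by apply/measurable_EFinP; exact: mi.
rewrite !integral_indic// !setIT integral_cst//; apply: leeD2l.
rewrite -[leRHS]mule1; apply: lee_wpmul2l; first by rewrite lee_fin.
exact: probability_le1.
Qed.

End error_bounds.

(** * Mass of the effect law near the thresholds *)

Section density_bounds.
Context {R : realType} (nu : probability (measurableTypeR R) R).
Context (U : set R) (rho : R -> R).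
Hypothesis nuU : density_on nu U rho.
Hypothesis rho_gt0 : forall x, U x -> 0 < rho x.
Local Notation seg_mass := (seg_mass nu).

Lemma seg_mass_density (x y : R) : `[x, y]%classic `<=` U ->
  (seg_mass x y)%:E = (\int[lebesgue_measure]_(t in `[x, y]) (rho t)%:E)%E.
Proof. by move=> xyU; rewrite -seg_massE nuU.2. Qed.

Let mrho (x y : R) : `[x, y]%classic `<=` U -> measurable U ->
  measurable_fun (`[x, y]%classic : set (measurableTypeR R)) (fun t => (rho t)%:E).
Proof.
move=> xyU mU; apply/measurable_EFinP; exact: measurable_funS nuU.1.
Qed.

Lemma seg_mass_density_ub (x y M : R) : measurable U -> x <= y ->
  `[x, y]%classic `<=` U -> (forall t, `[x, y]%classic t -> rho t <= M) ->
  seg_mass x y <= M * (y - x).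
Proof.
move=> mU xy xyU M_ub; rewrite -lee_fin (seg_mass_density xyU).
have -> : (M * (y - x))%:E = (\int[lebesgue_measure]_(t in `[x, y]) M%:E)%E.
  rewrite integral_cst//= lebesgue_measure_itv/= lte_fin.
  case: ltP => [_|yx]; first by rewrite -EFinB -EFinM.
  have -> : y = x by apply/eqP; rewrite eq_le xy yx.
  by rewrite subrr mulr0 mule0.
apply: ge0_le_integral => //.
- by move=> t /xyU /rho_gt0 /ltW; rewrite lee_fin.
- exact: mrho.
Qed.

Lemma seg_mass_density_lb (x y l : R) : measurable U -> 0 <= l -> x <= y ->
  `[x, y]%classic `<=` U -> (forall t, `[x, y]%classic t -> l <= rho t) ->
  l * (y - x) <= seg_mass x y.
Proof.
move=> mU l0 xy xyU l_lb; rewrite -lee_fin (seg_mass_density xyU).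
have -> : (l * (y - x))%:E = (\int[lebesgue_measure]_(t in `[x, y]) l%:E)%E.
  rewrite integral_cst//= lebesgue_measure_itv/= lte_fin.
  case: ltP => [_|yx]; first by rewrite -EFinB -EFinM.
  have -> : y = x by apply/eqP; rewrite eq_le xy yx.
  by rewrite subrr mulr0 mule0.
apply: ge0_le_integral => //.
exact: mrho.
Qed.

(** Otherwise the density would vanish almost everywhere on a segment of
    positive length. *)
Lemma seg_mass_density_gt0 (x y : R) : measurable U -> x < y ->
  `[x, y]%classic `<=` U -> 0 < seg_mass x y.
Proof.
move=> mU xy xyU; rewrite lt_neqAle seg_mass_ge0 andbT; apply/eqP => seg0.
have := seg_mass_density xyU; rewrite -seg0.
have -> : (\int[lebesgue_measure]_(t in `[x, y]) (rho t)%:E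
    = \int[lebesgue_measure]_(t in `[x, y]) `|(rho t)%:E|)%E.
  apply: eq_integral => t; rewrite inE => /xyU /rho_gt0 h.
  by rewrite abse_EFin ger0_norm// ltW.
have mI : measurable (`[x, y]%classic : set (measurableTypeR R)).
  exact: measurable_itv.
move/esym/(ae_eq_integral_abs lebesgue_measure mI (mrho xyU mU)).1.
move=> [N [mN N0 sN]].
have IN : `[x, y]%classic `<=` N.
  move=> t txy; apply: sN => /(_ txy) /= [] rho0.
  by have := rho_gt0 (xyU _ txy); rewrite rho0 ltxx.
have : (lebesgue_measure (`[x, y]%classic : set (measurableTypeR R)) <= lebesgue_measure N)%E.
  by apply: le_measure; rewrite ?inE.
by rewrite N0 lebesgue_measure_itv/= lte_fin xy -EFinB lee_fin subr_le0 leNgt xy.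
Qed.

End density_bounds.

Lemma seg_mass_cat_le {R : realType} (nu : probability (measurableTypeR R) R) (x y z : R) :
  seg_mass nu x z <= seg_mass nu x y + seg_mass nu y z.
Proof.
rewrite -lee_fin EFinD -!seg_massE.
apply: (@le_trans _ _ (nu (`[x, y]%classic `|` `[y, z]%classic))); last first.
  exact: measureU2.
apply: le_measure; rewrite ?inE//; first exact: measurableU.
move=> t /=; rewrite !in_itv/= => /andP[xt tz].
by have [ty|yt] := leP t y; [left; rewrite xt|right; rewrite (ltW yt) tz].
Qed.

Lemma seg_mass_disjoint_le {R : realType} (nu : probability (measurableTypeR R) R)
    (x y z w : R) : y < z -> x <= y -> z <= w ->
  seg_mass nu x y + seg_mass nu z w <= seg_mass nu x w.
Proof.
move=> yz xy zw; rewrite -lee_fin EFinD -!seg_massE -measureU//.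
  apply: le_measure; rewrite ?inE//; first exact: measurableU.
  move=> t /=; rewrite !in_itv/= => -[/andP[xt ty]|/andP[zt tw]].
    by rewrite xt (le_trans ty)// ltW// (lt_le_trans yz).
  by rewrite tw andbT (le_trans xy)// ltW// (lt_le_trans yz).
apply/seteqP; split => // t /=; rewrite !in_itv/= => -[/andP[_ ty] /andP[zt _]].
by have := lt_le_trans yz (le_trans zt ty); rewrite ltxx.
Qed.

(** All that the asymptotic analysis uses about the effect law near the
    thresholds [- s m] and [s m].  The clauses say, up to constants, that the
    mass is continuous at this scale, that it increases strictly beyond it,
    and that it is of the exact order [s m]. *)
Definition regular_at_scale {R : realType} (nu : probability (measurableTypeR R) R)
    (s : nat -> R) : Prop :=
  [/\ forall eta, 0 < eta -> exists2 k, 0 < k <= 4^-1 &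
        \forall m \near \oo,
          seg_mass nu (- ((1 + k) * s m)) ((1 + k) * s m)
          <= seg_mass nu (- ((1 - k) * s m)) ((1 - k) * s m) + eta * s m,
      exists2 k0, 0 < k0 & forall k1 k2, 0 < k1 -> k1 < k2 -> k2 <= k0 ->
        exists2 c, 0 < c & \forall m \near \oo,
          c * s m <= seg_mass nu ((1 + k1) * s m) ((1 + k2) * s m) /\
          c * s m <= seg_mass nu (- ((1 + k2) * s m)) (- ((1 + k1) * s m)),
      forall B, 0 < B -> exists2 K, 0 < K & \forall m \near \oo,
        seg_mass nu (- (B * s m)) (B * s m) <= K * s m &
      exists2 c, 0 < c & \forall m \near \oo,
        c * s m <= seg_mass nu (- s m) (s m)].

Section regularity.
Context {R : realType} (nu : probability (measurableTypeR R) R).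
Variables (s : nat -> R).
Local Notation seg := (seg_mass nu).

(** The segment is the union of a smaller one and of two collars. *)
Lemma annulus_le (k x M : R) : 0 < k -> k < 1 -> 0 < x ->
  seg (- ((1 + k) * x)) (- ((1 - k) * x)) <= M * (2 * k * x) ->
  seg ((1 - k) * x) ((1 + k) * x) <= M * (2 * k * x) ->
  seg (- ((1 + k) * x)) ((1 + k) * x)
  <= seg (- ((1 - k) * x)) ((1 - k) * x) + 4 * M * k * x.
Proof.
move=> k0 k1 x0 hl hr.
have h1 := seg_mass_cat_le nu (- ((1 + k) * x)) (- ((1 - k) * x)) ((1 + k) * x).
have h2 := seg_mass_cat_le nu (- ((1 - k) * x)) ((1 - k) * x) ((1 + k) * x).
by lra.
Qed.

(** If [s] tends to 0, all masses are comparable with lengths. *)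
Lemma regular_near0 (e l M : R) : 0 < e -> 0 < l -> 0 < M ->
  (forall x y, - e <= x -> x <= y -> y <= e -> seg x y <= M * (y - x)) ->
  (forall x y, 0 < x -> x <= y -> y <= e -> l * (y - x) <= seg x y) ->
  (forall x y, - e <= x -> x <= y -> y < 0 -> l * (y - x) <= seg x y) ->
  (\forall m \near \oo, 0 < s m) -> s m @[m --> \oo] --> (0 : R) ->
  regular_at_scale nu s.
Proof.
move=> e0 l0 M0 ub lbr lbl spos s0.
have small B : 0 < B -> \forall m \near \oo, B * s m <= e.
  move=> B0; have : \forall m \near \oo, `|0 - s m| < e / B.
    by move/cvgrPdist_lt : s0; apply; rewrite divr_gt0.
  apply: filterS => m; rewrite sub0r normrN => h.
  rewrite mulrC -ler_pdivlMr//; apply: ltW; apply: le_lt_trans h.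
  exact: ler_norm.
split.
- move=> eta eta0.
  pose k := Num.min 4^-1 (eta / (4 * M)).
  have k0 : 0 < k by rewrite lt_min invr_gt0 ltr0n/= divr_gt0// mulr_gt0.
  have k4 : k <= 4^-1 by rewrite ge_min lexx.
  have kM : 4 * M * k <= eta.
    by rewrite mulrC -ler_pdivlMr ?mulr_gt0// ge_min lexx orbT.
  clearbody k; exists k; first by rewrite k0 k4.
  near=> m.
  have sm : 0 < s m by near: m.
  have sm2 : 2 * s m <= e by near: m; exact: small.
  have ks : k * s m <= 4^-1 * s m by rewrite ler_pM2r.
  have ks0 : 0 < k * s m by rewrite mulr_gt0.
  have k1 : k < 1 by lra.
  have h : 4 * M * k * s m <= eta * s m by rewrite ler_pM2r.
  apply: le_trans (annulus_le (M := M) k0 k1 sm _ _) _.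
  + apply: le_trans (ub _ _ _ _ _) _; lra.
  + apply: le_trans (ub _ _ _ _ _) _; lra.
  + by lra.
- exists 1 => // k1 k2 k10 k12 k21; exists (l * (k2 - k1)).
    by rewrite mulr_gt0// subr_gt0.
  near=> m.
  have sm : 0 < s m by near: m.
  have sm2 : 2 * s m <= e by near: m; exact: small.
  have k1s : 0 < k1 * s m by rewrite mulr_gt0.
  have k12s : k1 * s m <= k2 * s m by rewrite ler_pM2r// ltW.
  have k2s : k2 * s m <= s m by rewrite ler_piMl// ltW.
  split.
  + apply: le_trans (lbr _ _ _ _ _); lra.
  + apply: le_trans (lbl _ _ _ _ _); lra.
- move=> B B0; exists (2 * B * M); first by rewrite !mulr_gt0.
  near=> m.
  have sm : 0 < s m by near: m.
  have smB : B * s m <= e by near: m; exact: small.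
  have Bs : 0 < B * s m by rewrite mulr_gt0.
  apply: le_trans (ub _ _ _ _ _) _; lra.
- exists (l / 2); first by rewrite divr_gt0.
  near=> m.
  have sm : 0 < s m by near: m.
  have sm1 : 1 * s m <= e by near: m; exact: small.
  apply: (@le_trans _ _ (seg (s m / 2) (s m))); last by apply: seg_mass_le; lra.
  apply: le_trans (lbr _ _ _ _ _); lra.
Unshelve. all: end_near. Qed.

(** If [s] tends to [T > 0], a mass of order [s m] is a mass of order 1, and
    only small neighbourhoods of [- T] and [T] matter. *)
Lemma regular_nearT (T e M : R) : 0 < T -> 0 < e -> e <= T -> 0 < M ->
  (forall x y, T - e <= x -> x <= y -> y <= T + e -> seg x y <= M * (y - x)) ->
  (forall x y, - T - e <= x -> x <= y -> y <= - T + e -> seg x y <= M * (y - x)) ->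
  (forall x y, T - e <= x -> x < y -> y <= T + e -> 0 < seg x y) ->
  (forall x y, - T - e <= x -> x < y -> y <= - T + e -> 0 < seg x y) ->
  s m @[m --> \oo] --> T ->
  regular_at_scale nu s.
Proof.
move=> T0 e0 eT M0 ubr ubl posr posl sT.
have near_lo d : d < T -> \forall m \near \oo, d <= s m.
  by move=> dT; exact: (cvgr_ge T).
have near_hi d : T < d -> \forall m \near \oo, s m <= d.
  by move=> dT; exact: (cvgr_le T).
split.
- move=> eta eta0.
  pose k := Num.min 4^-1 (Num.min (e / (4 * T)) (eta / (4 * M))).
  have k0 : 0 < k by rewrite !lt_min invr_gt0 ltr0n/= !divr_gt0// mulr_gt0.
  have k4 : k <= 4^-1 by rewrite ge_min lexx.
  have kM : 4 * M * k <= eta.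
    by rewrite mulrC -ler_pdivlMr ?mulr_gt0// !ge_min lexx !orbT.
  have kT : 4 * T * k <= e.
    by rewrite mulrC -ler_pdivlMr ?mulr_gt0// !ge_min lexx !orbT.
  clearbody k; exists k; first by rewrite k0 k4.
  near=> m.
  have slo : T - e / 2 <= s m by near: m; apply: near_lo; lra.
  have shi : s m <= T + e / 2 by near: m; apply: near_hi; lra.
  have sm : 0 < s m by lra.
  have ks : k * s m <= k * (2 * T) by rewrite ler_pM2l//; lra.
  have ks0 : 0 < k * s m by rewrite mulr_gt0.
  have k1 : k < 1 by lra.
  have h : 4 * M * k * s m <= eta * s m by rewrite ler_pM2r.
  apply: le_trans (annulus_le (M := M) k0 k1 sm _ _) _.
  + apply: le_trans (ubl _ _ _ _ _) _; lra.
  + apply: le_trans (ubr _ _ _ _ _) _; lra.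
  + by lra.
- exists (e / T); first by rewrite divr_gt0.
  move=> k1 k2 k10 k12 k2e.
  (* Fixed factors strictly between [k1] and [k2] absorb the error of the
     approximation of [T] by [s m]. *)
  pose j1 := (2 * k1 + k2) / 3; pose j2 := (k1 + 2 * k2) / 3.
  have [k1j1 j12 j2k2] : [/\ k1 < j1, j1 < j2 & j2 < k2] by split; rewrite /j1 /j2; lra.
  have k2T : k2 * T <= e by rewrite -ler_pdivlMr.
  have j1T : 0 < j1 * T by rewrite mulr_gt0//; lra.
  have j12T : j1 * T < j2 * T by rewrite ltr_pM2r.
  have j2T : j2 * T < k2 * T by rewrite ltr_pM2r.
  pose cr := seg ((1 + j1) * T) ((1 + j2) * T).
  pose cl := seg (- ((1 + j2) * T)) (- ((1 + j1) * T)).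
  have cr0 : 0 < cr by apply: posr; lra.
  have cl0 : 0 < cl by apply: posl; lra.
  pose c := Num.min cr cl / (2 * T).
  have c0 : 0 < c by rewrite divr_gt0 ?mulr_gt0// lt_min cr0 cl0.
  exists c => //; near=> m.
  have slo : (1 + j2) / (1 + k2) * T <= s m.
    near: m; apply: near_lo; rewrite gtr_pMl// ltr_pdivrMr; lra.
  have shi : s m <= (1 + j1) / (1 + k1) * T.
    near: m; apply: near_hi; rewrite ltr_pMl// ltr_pdivlMr; lra.
  have shi2 : s m <= 2 * T by near: m; apply: near_hi; lra.
  have E2 : (1 + j2) * T <= (1 + k2) * s m.
    have k2p : 0 < 1 + k2 by lra.
    by rewrite -ler_pdivrMl// mulrA [_^-1 * _]mulrC.
  have E1 : (1 + k1) * s m <= (1 + j1) * T.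
    have k1p : 0 < 1 + k1 by lra.
    by rewrite -ler_pdivlMl// mulrA [_^-1 * _]mulrC.
  have cs : c * s m <= Num.min cr cl.
    apply: (@le_trans _ _ (c * (2 * T))); first by rewrite ler_pM2l.
    by rewrite /c divfK// gt_eqF// mulr_gt0.
  split; apply: (le_trans cs).
    by apply: (@le_trans _ _ cr); [rewrite ge_min lexx|apply: seg_mass_le].
  apply: (@le_trans _ _ cl); first by rewrite ge_min lexx orbT.
  by apply: seg_mass_le; rewrite lerN2.
- move=> B B0; exists (2 / T); first by rewrite divr_gt0.
  near=> m.
  have slo : T / 2 <= s m by near: m; apply: near_lo; lra.
  apply: le_trans (seg_mass_le1 _ _ _) _.
  by rewrite mulrAC ler_pdivlMr//; lra.
- pose c0 := seg (T - e / 2) (T - e / 4).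
  have c00 : 0 < c0 by apply: posr; lra.
  exists (c0 / (2 * T)); first by rewrite divr_gt0// mulr_gt0.
  near=> m.
  have slo : T - e / 4 <= s m by near: m; apply: near_lo; lra.
  have shi : s m <= 2 * T by near: m; apply: near_hi; lra.
  apply: (@le_trans _ _ c0); last by apply: seg_mass_le; lra.
  by rewrite mulrAC ler_pdivrMr ?mulr_gt0// ler_pM2l.
Unshelve. all: end_near. Qed.

(** For [C = 0] the one-sided limits bound the density away from 0 near 0. *)
Lemma assumptionC_regular (sigma C : R) : 0 < sigma -> 0 <= C ->
  assumptionC nu sigma C -> (\forall m \near \oo, 0 < s m) ->
  s m @[m --> \oo] --> sigma * Num.sqrt C -> regular_at_scale nu s.
Proof.
move=> sig0 C0 [e [rho]]; set T := sigma * Num.sqrt C; set U := _ `|` _.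
move=> [e0 nuU rho0 [M0 rhoM0] rho_lim] spos sT.
have mU : measurable U by apply: measurableU; exact: measurable_itv.
pose M := Num.max M0 1.
have M1 : 0 < M by rewrite lt_max ltr01 orbT.
have rhoM x : U x -> rho x <= M by move=> Ux; rewrite le_max rhoM0.
have T0 : 0 <= T by rewrite mulr_ge0// ?sqrtr_ge0// ltW.
have Ur x y t : T - e <= x -> y <= T + e -> `[x, y]%classic t -> U t.
  move=> xe ye; rewrite /= in_itv/= => /andP[xt ty]; right.
  by rewrite /= in_itv/= (le_trans xe)// (le_trans ty).
have Ul x y t : - T - e <= x -> y <= - T + e -> `[x, y]%classic t -> U t.
  move=> xe ye; rewrite /= in_itv/= => /andP[xt ty]; left.
  by rewrite /= in_itv/= (le_trans xe)// (le_trans ty).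
have [C_eq0|C_neq0] := eqVneq C 0.
  have T_eq0 : T = 0 by rewrite /T C_eq0 sqrtr0 mulr0.
  have [l [r [l0 r0 rhol rhor]]] := rho_lim C_eq0.
  have [e1 e10 he1] : exists2 e1, 0 < e1 & forall t, 0 < t < e1 -> r / 2 <= rho t.
    have : \forall t \near 0^'+, r / 2 <= rho t.
      by apply: (cvgr_ge r) => //; lra.
    move=> -[d /= d0 hd]; exists d => // t /andP[t0 td].
    by apply: hd => //=; rewrite sub0r normrN gtr0_norm.
  have [e2 e20 he2] : exists2 e2, 0 < e2 & forall t, - e2 < t < 0 -> l / 2 <= rho t.
    have : \forall t \near 0^'-, l / 2 <= rho t.
      by apply: (cvgr_ge l) => //; lra.
    move=> -[d /= d0 hd]; exists d => // t /andP[td t0].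
    by apply: hd => //=; rewrite sub0r normrN ltr0_norm// ltrNl.
  pose e' := Num.min e (Num.min (e1 / 2) (e2 / 2)).
  have e'0 : 0 < e' by rewrite !lt_min e0 !divr_gt0.
  have e'e : e' <= e by rewrite ge_min lexx.
  have e'1 : e' <= e1 / 2 by rewrite !ge_min lexx !orbT.
  have e'2 : e' <= e2 / 2 by rewrite !ge_min lexx !orbT.
  pose l' := Num.min (r / 2) (l / 2).
  have l'0 : 0 < l' by rewrite lt_min !divr_gt0.
  have l'r : l' <= r / 2 by rewrite ge_min lexx.
  have l'l : l' <= l / 2 by rewrite ge_min lexx orbT.
  apply: (@regular_near0 e' l' M) => //; last by rewrite -T_eq0.
  - move=> x y ex xy ye.
    have xyU : `[x, y]%classic `<=` U by move=> t; apply: Ur; lra.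
    by apply: (seg_mass_density_ub nuU) => // t /xyU; exact: rhoM.
  - move=> x y x0 xy ye.
    have xyU : `[x, y]%classic `<=` U by move=> t; apply: Ur; lra.
    apply: (seg_mass_density_lb nuU) => //; first exact: ltW.
    move=> t; rewrite /= in_itv/= => /andP[xt ty].
    by apply: (le_trans l'r); apply: he1; apply/andP; split; lra.
  - move=> x y ex xy y0.
    have xyU : `[x, y]%classic `<=` U by move=> t; apply: Ur; lra.
    apply: (seg_mass_density_lb nuU) => //; first exact: ltW.
    move=> t; rewrite /= in_itv/= => /andP[xt ty].
    by apply: (le_trans l'l); apply: he2; apply/andP; split; lra.
have Tpos : 0 < T by rewrite mulr_gt0// sqrtr_gt0 lt_neqAle eq_sym C_neq0.
pose e' := Num.min e T.
have e'0 : 0 < e' by rewrite lt_min e0.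
have e'e : e' <= e by rewrite ge_min lexx.
have e'T : e' <= T by rewrite ge_min lexx orbT.
apply: (@regular_nearT T e' M) => //.
- move=> x y ex xy ye.
  have xyU : `[x, y]%classic `<=` U by move=> t; apply: Ur; lra.
  by apply: (seg_mass_density_ub nuU) => // t /xyU; exact: rhoM.
- move=> x y ex xy ye.
  have xyU : `[x, y]%classic `<=` U by move=> t; apply: Ul; lra.
  by apply: (seg_mass_density_ub nuU) => // t /xyU; exact: rhoM.
- move=> x y ex xy ye.
  have xyU : `[x, y]%classic `<=` U by move=> t; apply: Ur; lra.
  exact: (seg_mass_density_gt0 nuU).
- move=> x y ex xy ye.
  have xyU : `[x, y]%classic `<=` U by move=> t; apply: Ul; lra.
  exact: (seg_mass_density_gt0 nuU).
Qed.

End regularity.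

(** * Asymptotically optimal thresholds *)

Lemma expR_ge_sqr {R : realType} (x : R) : 0 <= x -> x ^+ 2 / 4 <= expR x.
Proof.
move=> x0; have -> : expR x = expR (x / 2) ^+ 2.
  by rewrite -expRM_natl; congr expR; field.
apply: (@le_trans _ _ ((x / 2) ^+ 2)); first by rewrite expr_div_n; lra.
rewrite ler_sqr ?nnegrE ?expR_ge0 ?divr_ge0//.
by apply: le_trans (expR_ge1Dx _); rewrite lerDr.
Qed.

(** Risk of one test divided by [p * deltaA]; the ratio of two risks is the
    ratio of these costs.  It is locked because unfolding it makes unification
    compare integrals. *)
HB.lock Definition test_cost {R : realType}
    (nu : probability (measurableTypeR R) R) (df e u w : R) : R :=
  df * type1_error e u w + type2_error nu e u w.

Local Opaque type1_error type2_error normal_tail seg_mass.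

(** [L] stands for [log v], [e] for the standard deviation of the sample mean,
    [s] for the scale [e * sqrt L] of the optimal thresholds and [df] for
    [delta * f].  A threshold [b * s] is [b * sqrt L] standard deviations away
    from 0, so its type I cost is [df * Q (b * sqrt L)]. *)
Section asymptotics.
Context {R : realType} (nu : probability (measurableTypeR R) R).
Variables (sigma c0 : R) (L s e df : nat -> R).
Hypothesis sigma_gt0 : 0 < sigma.
Hypothesis c0_gt0 : 0 < c0.
Hypothesis L_cvg : L m @[m --> \oo] --> +oo.
Hypothesis e_gt0 : \forall m \near \oo, 0 < e m.
Hypothesis sE : \forall m \near \oo, s m = e m * Num.sqrt (L m).
Hypothesis dfE : \forall m \near \oo,
  df m * (sigma * Num.sqrt (L m)) = s m * expR (L m / 2).
Hypothesis df_ge : \forall m \near \oo, c0 <= df m.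
Hypothesis nu_regular : regular_at_scale nu s.
Local Notation Q := (@normal_tail R).
Local Notation seg := (seg_mass nu).
Local Notation k0 := (normal_peak (1 : R)).

Let k0_gt0 : 0 < k0. Proof. by rewrite normal_peak_gt0// oner_neq0. Qed.

Lemma L_ge (A : R) : \forall m \near \oo, A <= L m.
Proof. exact: (cvgry_ge L_cvg). Qed.

Lemma s_gt0 : \forall m \near \oo, 0 < s m.
Proof.
near=> m; have -> : s m = e m * Num.sqrt (L m) by near: m.
rewrite mulr_gt0//; first by near: m.
by rewrite sqrtr_gt0 (lt_le_trans ltr01)//; near: m; exact: L_ge.
Unshelve. all: end_near. Qed.

Lemma sqrtL_ge (A : R) : \forall m \near \oo, A <= Num.sqrt (L m).
Proof.
near=> m; apply: (@le_trans _ _ `|A|); first exact: ler_norm.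
rewrite -sqrtr_sqr ler_wsqrtr//; near: m; exact: L_ge.
Unshelve. all: end_near. Qed.

Lemma normal_tail_le_inv (x : R) : 0 < x -> Q x <= k0 / x.
Proof.
move=> x0; apply: le_trans (normal_tail_ub x0) _.
rewrite ler_piMr ?(ltW (divr_gt0 k0_gt0 x0))// -[leRHS]expR0 ler_expR oppr_le0.
by rewrite divr_ge0// sqr_ge0.
Qed.

Lemma tail_small (k eta : R) : 0 < k -> 0 < eta ->
  \forall m \near \oo, Q (k * Num.sqrt (L m)) <= eta.
Proof.
move=> k_gt0 eta0; near=> m.
have t1 : 1 <= Num.sqrt (L m) by near: m; exact: sqrtL_ge.
have t2 : k0 / (k * eta) <= Num.sqrt (L m) by near: m; exact: sqrtL_ge.
have kt0 : 0 < k * Num.sqrt (L m) by rewrite mulr_gt0//; lra.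
apply: le_trans (normal_tail_le_inv kt0) _.
rewrite ler_pdivrMr//; move: t2; rewrite ler_pdivrMr ?mulr_gt0//.
lra.
Unshelve. all: end_near. Qed.

(** For the threshold [b * s] the number [z] of the theorem is
    [L * (b ^+ 2 - 1)], so that this is [z + 2 log log v]. *)
Definition excess (m : nat) (b : R) : R := L m * (b ^+ 2 - 1) + 2 * ln (L m).

(** The factor [expR (L / 2)] of [df] cancels against the normal density at
    [sqrt L], and what the threshold [b * s] adds to the exponent is its excess.
    Hence the type I cost is [s * expR (- excess / 2)] up to constants. *)
Let dfQE (m : nat) (b k : R) : 0 < L m -> 0 < b ->
  df m * (sigma * Num.sqrt (L m)) = s m * expR (L m / 2) ->
  df m * (k / (b * Num.sqrt (L m)) * expR (- ((b * Num.sqrt (L m)) ^+ 2 / 2)))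
  = s m * (k / (sigma * b)) * expR (- (excess m b / 2)).
Proof.
move=> Lm b0 dE.
have t0 : 0 < Num.sqrt (L m) by rewrite sqrtr_gt0.
have -> : df m = s m * expR (L m / 2) / (sigma * Num.sqrt (L m)).
  by rewrite -dE mulfK// gt_eqF// mulr_gt0.
have -> : expR (- (excess m b / 2))
    = expR (L m / 2) * expR (- ((b * Num.sqrt (L m)) ^+ 2 / 2)) / L m.
  have -> : (L m)^-1 = expR (- ln (L m)) by rewrite expRN lnK ?posrE.
  rewrite -!expRD exprMn sqr_sqrtr ?ltW//.
  by congr expR; rewrite /excess; field.
move: (expR (L m / 2)) (expR (- ((b * _) ^+ 2 / 2))) => E1 E2.
rewrite -[L m in RHS](sqr_sqrtr (ltW Lm)).
by move: (Num.sqrt (L m)) t0 => t t0; field; rewrite !gt_eqF.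
Qed.

Lemma type1_tail_ub : \forall m \near \oo, forall b, 0 < b ->
  df m * Q (b * Num.sqrt (L m))
  <= s m * (k0 / (sigma * b)) * expR (- (excess m b / 2)).
Proof.
near=> m => b b0.
have L1 : 1 <= L m by near: m; exact: L_ge.
have L0 : 0 < L m by lra.
rewrite -(dfQE k0 L0 b0); last by near: m.
rewrite ler_pM2l; last by apply: (lt_le_trans c0_gt0); near: m.
by apply: normal_tail_ub; rewrite mulr_gt0// sqrtr_gt0.
Unshelve. all: end_near. Qed.

Let k1 := k0 * expR (- (3 / 2)).
Let k1_gt0 : 0 < k1. Proof. by rewrite mulr_gt0// expR_gt0. Qed.

Lemma type1_tail_lb : \forall m \near \oo, forall b, 0 < b ->
  1 <= b * Num.sqrt (L m) ->
  s m * (k1 / (sigma * b)) * expR (- (excess m b / 2))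
  <= df m * Q (b * Num.sqrt (L m)).
Proof.
near=> m => b b0 bt.
have L1 : 1 <= L m by near: m; exact: L_ge.
have L0 : 0 < L m by lra.
rewrite -(dfQE k1 L0 b0); last by near: m.
rewrite ler_pM2l; last by apply: (lt_le_trans c0_gt0); near: m.
exact: normal_tail_lb.
Unshelve. all: end_near. Qed.

(** By monotonicity it suffices to consider the threshold [(1 - k) * s].  Its
    excess tends to [-oo] linearly in [L], so its cost exceeds [s] by a factor
    that is exponential in [L]. *)
Lemma type1_low_threshold (k B : R) : 0 < k < 1 -> \forall m \near \oo,
  forall b, b < 1 - k -> B * s m < df m * Q (b * Num.sqrt (L m)).
Proof.
move=> /andP[k_gt0 k_lt1].
pose b0 := 1 - k; have b00 : 0 < b0 by rewrite /b0; lra.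
(* Half of the rate at which the excess of the threshold [b0 * s] decreases. *)
pose q := (1 - b0 ^+ 2) / 2.
have b0sq : b0 ^+ 2 < 1 by rewrite expr_lt1//; rewrite /b0; lra.
have q0 : 0 < q by rewrite /q; lra.
near=> m => b bk.
have L1 : 1 <= L m by near: m; exact: L_ge.
have L0 : 0 < L m by lra.
have sm : 0 < s m by near: m; exact: s_gt0.
have t1 : b0^-1 <= Num.sqrt (L m) by near: m; exact: sqrtL_ge.
have L2 : (B + 1) / (k1 / (sigma * b0) * (q ^+ 2 / 4)) <= L m.
  by near: m; exact: L_ge.
have df0 : 0 < df m by apply: (lt_le_trans c0_gt0); near: m.
have bt : 1 <= b0 * Num.sqrt (L m) by rewrite -ler_pdivrMl// mulr1.
have lb : forall b, 0 < b -> 1 <= b * Num.sqrt (L m) ->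
    s m * (k1 / (sigma * b)) * expR (- (excess m b / 2))
    <= df m * Q (b * Num.sqrt (L m)) by near: m; exact: type1_tail_lb.
have mono : df m * Q (b0 * Num.sqrt (L m)) <= df m * Q (b * Num.sqrt (L m)).
  by rewrite ler_pM2l//; apply: normal_tail_le; rewrite ler_wpM2r ?sqrtr_ge0// ltW.
apply: lt_le_trans mono; apply: lt_le_trans (lb _ b00 bt).
have kb0 : 0 < k1 / (sigma * b0) by rewrite divr_gt0// mulr_gt0.
have -> : expR (- (excess m b0 / 2)) = expR (q * L m) / L m.
  have -> : (L m)^-1 = expR (- ln (L m)) by rewrite expRN lnK ?posrE.
  by rewrite -expRD; congr expR; rewrite /excess /q; field.
have expL : q ^+ 2 / 4 * L m <= expR (q * L m) / L m.
  rewrite ler_pdivlMr//; apply: le_trans (expR_ge_sqr _); last first.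
    by rewrite mulr_ge0// ltW.
  by rewrite le_eqVlt; apply/orP; left; apply/eqP; ring.
rewrite -mulrA mulrC ltr_pM2l//.
apply: (@lt_le_trans _ _ (k1 / (sigma * b0) * (q ^+ 2 / 4 * L m))).
  move: L2; rewrite ler_pdivrMr; last by rewrite mulr_gt0// divr_gt0// exprn_gt0.
  by move=> L2; apply: (@lt_le_trans _ _ (B + 1)); lra.
by rewrite ler_pM2l.
Unshelve. all: end_near. Qed.

(** A type I cost that is small in comparison with [s] forces the excess to be
    large: thresholds above [2 * s] have a large excess anyway, those below
    [s / 2] are too expensive, and in between the Mills lower bound applies. *)
Lemma type1_small_excess (A : R) : exists2 eta, 0 < eta &
  \forall m \near \oo, forall b, 0 < b ->
    df m * Q (b * Num.sqrt (L m)) <= eta * s m -> A <= excess m b.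
Proof.
(* The bound 1 excludes the thresholds below [s / 2]; the other term is the
   Mills lower bound, divided by [s], for a threshold of at most [2 * s] and excess [A]. *)
pose eta := Num.min 1 (k1 / (2 * sigma) * expR (- (A / 2))).
have eta0 : 0 < eta.
  by rewrite lt_min ltr01 mulr_gt0 ?expR_gt0// divr_gt0// mulr_gt0.
exists eta => //; near=> m => b b0 small.
have L1 : 4 <= L m by near: m; exact: L_ge.
have LA : A <= L m by near: m; exact: L_ge.
have sm : 0 < s m by near: m; exact: s_gt0.
have lnL : 0 <= ln (L m) by apply: ln_ge0; lra.
have low : forall b, b < 1 - 2^-1 -> 1 * s m < df m * Q (b * Num.sqrt (L m)).
  by near: m; apply: type1_low_threshold; lra.
have [b2|b2] := leP 2 b.
  have b4 : 4 <= b ^+ 2 by rewrite expr2; nra.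
  by rewrite /excess; nra.
have bhalf : 2^-1 <= b.
  rewrite leNgt; apply/negP => bh.
  have := low b; have -> : (1 - 2^-1 : R) = 2^-1 by field.
  move=> /(_ bh); rewrite ltNge => /negP; apply.
  by apply: (le_trans small); rewrite ler_pM2r// ge_min lexx.
have t2 : 2 <= Num.sqrt (L m) by near: m; exact: sqrtL_ge.
have lb : forall b, 0 < b -> 1 <= b * Num.sqrt (L m) ->
    s m * (k1 / (sigma * b)) * expR (- (excess m b / 2))
    <= df m * Q (b * Num.sqrt (L m)) by near: m; exact: type1_tail_lb.
have bt : 1 <= b * Num.sqrt (L m).
  by have -> : 1 = 2^-1 * 2 :> R; [field|apply: ler_pM].
have {}lb := le_trans (lb b b0 bt) small.
have kb : k1 / (2 * sigma) <= k1 / (sigma * b).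
  rewrite ler_pM2l// lef_pV2 ?posrE ?mulr_gt0// mulrC ler_pM2r//; exact: ltW.
have ek : eta <= k1 / (2 * sigma) * expR (- (A / 2)) by rewrite ge_min lexx orbT.
have k2 : 0 < k1 / (2 * sigma) by rewrite divr_gt0// mulr_gt0.
have : s m * (k1 / (2 * sigma)) * expR (- (excess m b / 2))
    <= s m * (k1 / (2 * sigma)) * expR (- (A / 2)).
  apply: (@le_trans _ _ (s m * (k1 / (sigma * b)) * expR (- (excess m b / 2)))).
    by rewrite ler_pM2r ?expR_gt0// ler_pM2l.
  apply: (le_trans lb); rewrite -mulrA mulrC.
  by rewrite ler_pM2l.
rewrite ler_pM2l; last exact: mulr_gt0.
by rewrite ler_expR; lra.
Unshelve. all: end_near. Qed.

(** Conversely a large excess makes the type I cost small in comparison with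
    [s], provided that the threshold is not small itself. *)
Lemma type1_large_excess (eta : R) : 0 < eta -> exists A,
  \forall m \near \oo, forall b, 2^-1 <= b -> A <= excess m b ->
    df m * Q (b * Num.sqrt (L m)) <= eta * s m.
Proof.
move=> eta0; pose K := 2 * k0 / sigma.
have K0 : 0 < K by rewrite divr_gt0// mulr_gt0.
exists (- 2 * ln (eta / K)); near=> m => b bh Ab.
have b0 : 0 < b by lra.
have sm : 0 < s m by near: m; exact: s_gt0.
have ub : forall b, 0 < b -> df m * Q (b * Num.sqrt (L m))
  <= s m * (k0 / (sigma * b)) * expR (- (excess m b / 2)).
  by near: m; exact: type1_tail_ub.
apply: le_trans (ub _ b0) _; rewrite [leRHS]mulrC -mulrA ler_pM2l//.
have kb : k0 / (sigma * b) <= K.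
  rewrite ler_pdivrMr ?mulr_gt0// /K.
  have -> : 2 * k0 / sigma * (sigma * b) = k0 * (2 * b) by field; rewrite gt_eqF.
  by rewrite ler_pMr//; lra.
apply: (@le_trans _ _ (K * (eta / K))); last by rewrite mulrC divfK// gt_eqF.
apply: ler_pM => //; first by rewrite divr_ge0// ltW// mulr_gt0.
have ek0 : eta / K \is Num.pos by rewrite posrE divr_gt0.
rewrite -[leRHS](lnK ek0) ler_expR; lra.
Unshelve. all: end_near. Qed.

Let ratioE (k : R) : \forall m \near \oo, k * s m / e m = k * Num.sqrt (L m).
Proof.
near=> m; have -> : s m = e m * Num.sqrt (L m) by near: m.
have : 0 < e m by near: m.
by move=> em; field; rewrite gt_eqF.
Unshelve. all: end_near. Qed.

Let type2_margin (k : R) : \forall m \near \oo, forall x y, x < y ->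
  seg (x + k * s m) (y - k * s m) * (1 - 2 * Q (k * Num.sqrt (L m)))
  <= type2_error nu (e m) x y.
Proof.
near=> m => x y xy.
have <- : k * s m / e m = k * Num.sqrt (L m) by near: m; exact: ratioE.
by apply: type2_lb => //; near: m.
Unshelve. all: end_near. Qed.

(** Perturbing the thresholds [- s] and [s] by a small fraction of [s] changes
    the accepted mass by a small fraction of [s]. *)
Let sandwich (eta : R) : 0 < eta -> exists2 k, 0 < k <= 4^-1 &
  \forall m \near \oo,
    seg (- ((1 + k) * s m)) ((1 + k) * s m) <= seg (- s m) (s m) + eta * s m /\
    seg (- s m) (s m) <= seg (- ((1 - k) * s m)) ((1 - k) * s m) + eta * s m.
Proof.
move=> eta0; have [reg1 _ _ _] := nu_regular.
have [k k01 hk] := reg1 _ eta0; exists k => //; have /andP[k_gt0 k4] := k01.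
near=> m.
have sm : 0 < s m by near: m; exact: s_gt0.
have km : seg (- ((1 + k) * s m)) ((1 + k) * s m)
    <= seg (- ((1 - k) * s m)) ((1 - k) * s m) + eta * s m by near: m.
have ks : 0 < k * s m by rewrite mulr_gt0.
have h1 : seg (- ((1 - k) * s m)) ((1 - k) * s m) <= seg (- s m) (s m).
  by apply: seg_mass_le; lra.
have h2 : seg (- s m) (s m) <= seg (- ((1 + k) * s m)) ((1 + k) * s m).
  by apply: seg_mass_le; lra.
by split; lra.
Unshelve. all: end_near. Qed.

(** The noise is [s / sqrt L], hence small in comparison with [s]: almost all
    effects in a slightly shorter interval are accepted. *)
Lemma type2_lower_bound (eta : R) : 0 < eta -> exists2 k, 0 < k < 1 &
  \forall m \near \oo, forall x y,
    x <= - ((1 - k) * s m) -> (1 - k) * s m <= y ->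
    seg (- s m) (s m) - eta * s m <= type2_error nu (e m) x y.
Proof.
move=> eta0; have eta2 : 0 < eta / 2 by rewrite divr_gt0.
have [k /andP[k_gt0 k4] hk] := sandwich eta2.
have [_ _ /(_ 1 ltr01)[K K0 hK] _] := nu_regular.
exists (k / 2); first by apply/andP; split; lra.
near=> m => x y xk yk.
have sm : 0 < s m by near: m; exact: s_gt0.
have ks : 0 < k * s m by rewrite mulr_gt0.
have ks4 : k * s m <= 4^-1 * s m by rewrite ler_pM2r.
have km : seg (- s m) (s m) <= seg (- ((1 - k) * s m)) ((1 - k) * s m) + eta / 2 * s m.
  suff : seg (- ((1 + k) * s m)) ((1 + k) * s m) <= seg (- s m) (s m) + eta / 2 * s m /\
    seg (- s m) (s m) <= seg (- ((1 - k) * s m)) ((1 - k) * s m) + eta / 2 * s m.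
    by case.
  by near: m.
have Km : seg (- (1 * s m)) (1 * s m) <= K * s m by near: m.
have qK : Q (k / 2 * Num.sqrt (L m)) <= eta / (4 * K).
  by near: m; apply: tail_small; rewrite divr_gt0// mulr_gt0.
have xy : x < y by lra.
have mar : forall x y, x < y ->
    seg (x + k / 2 * s m) (y - k / 2 * s m) * (1 - 2 * Q (k / 2 * Num.sqrt (L m)))
    <= type2_error nu (e m) x y.
  by near: m; exact: type2_margin.
set q := Q (k / 2 * Num.sqrt (L m)) in qK mar.
have q0 : 0 <= q by exact: normal_tail_ge0.
have {}mar := mar _ _ xy.
set A := seg (- ((1 - k) * s m)) ((1 - k) * s m) in km.
have AB : A <= seg (x + k / 2 * s m) (y - k / 2 * s m) by apply: seg_mass_le; lra.
have A0 : 0 <= A by exact: seg_mass_ge0.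
have AK : A <= K * s m by apply: le_trans Km; apply: seg_mass_le; lra.
have qA : 2 * q * A <= eta / 2 * s m.
  apply: (@le_trans _ _ (2 * q * (K * s m))).
    by apply: ler_wpM2l => //; rewrite mulr_ge0.
  move: qK; rewrite ler_pdivlMr ?mulr_gt0// => qK.
  have : q * (4 * K) * s m <= eta * s m by rewrite ler_pM2r.
  lra.
have [q1|q1] := leP (2 * q) 1.
  have : A * (1 - 2 * q) <= seg (x + k / 2 * s m) (y - k / 2 * s m) * (1 - 2 * q).
    by apply: ler_wpM2r => //; rewrite subr_ge0.
  lra.
have em : 0 < e m by near: m.
have := type2_ge0 nu em x y.
have : A <= 2 * q * A by rewrite ler_peMl// ltW.
lra.
Unshelve. all: end_near. Qed.

(** Conversely, few effects outside a slightly longer interval are accepted.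
    The effects beyond [4 * s] may carry a mass of order 1, but their probability
    of acceptance is [o(s)], as [df] is bounded away from 0 and the type I cost
    of the threshold [2 * s] is [o(s)]. *)
Lemma type2_upper_bound (eta : R) : 0 < eta -> exists2 k, 0 < k < 1 &
  \forall m \near \oo, forall x y,
    - ((1 + k) * s m) <= x -> x < y -> y <= (1 + k) * s m ->
    type2_error nu (e m) x y <= seg (- s m) (s m) + eta * s m.
Proof.
move=> eta0; have eta3 : 0 < eta / 3 by rewrite divr_gt0.
have [k /andP[k_gt0 k4] hk] := sandwich eta3.
have four0 : 0 < 4 :> R by []. have four0' : 0 < 2 :> R by [].
have [_ _ /(_ 4 four0)[K K0 hK] _] := nu_regular.
exists (k / 2); first by apply/andP; split; lra.
near=> m => x y xk xy yk.
have L1 : 1 <= L m by near: m; exact: L_ge.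
have sm : 0 < s m by near: m; exact: s_gt0.
have em : 0 < e m by near: m.
have ks : 0 < k * s m by rewrite mulr_gt0.
have ks4 : k * s m <= 4^-1 * s m by rewrite ler_pM2r.
have km : seg (- ((1 + k) * s m)) ((1 + k) * s m) <= seg (- s m) (s m) + eta / 3 * s m.
  suff : seg (- ((1 + k) * s m)) ((1 + k) * s m) <= seg (- s m) (s m) + eta / 3 * s m /\
    seg (- s m) (s m) <= seg (- ((1 - k) * s m)) ((1 - k) * s m) + eta / 3 * s m.
    by case.
  by near: m.
have Km : seg (- (4 * s m)) (4 * s m) <= K * s m by near: m.
have ub : type2_error nu (e m) x y
    <= seg (x - k / 2 * s m) (y + k / 2 * s m)
       + Q (k / 2 * s m / e m) * seg (- (4 * s m)) (4 * s m) + Q (2 * s m / e m).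
  by apply: type2_ub => //; lra.
have E1 : k / 2 * s m / e m = k / 2 * Num.sqrt (L m) by near: m; exact: ratioE.
have E2 : 2 * s m / e m = 2 * Num.sqrt (L m) by near: m; exact: ratioE.
rewrite E1 E2 in ub.
have qK : Q (k / 2 * Num.sqrt (L m)) <= eta / (3 * K).
  by near: m; apply: tail_small; rewrite divr_gt0// mulr_gt0.
set q := Q (k / 2 * Num.sqrt (L m)) in ub qK.
have q0 : 0 <= q by exact: normal_tail_ge0.
have h1 : seg (x - k / 2 * s m) (y + k / 2 * s m)
    <= seg (- ((1 + k) * s m)) ((1 + k) * s m) by apply: seg_mass_le; lra.
have h2 : q * seg (- (4 * s m)) (4 * s m) <= eta / 3 * s m.
  apply: (@le_trans _ _ (q * (K * s m))); first exact: ler_wpM2l.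
  move: qK; rewrite ler_pdivlMr ?mulr_gt0// => qK.
  have : q * (3 * K) * s m <= eta * s m by rewrite ler_pM2r.
  lra.
have h3 : Q (2 * Num.sqrt (L m)) <= eta / 3 * s m.
  have low : forall b, 0 < b -> df m * Q (b * Num.sqrt (L m))
      <= s m * (k0 / (sigma * b)) * expR (- (excess m b / 2)).
    by near: m; exact: type1_tail_ub.
  have {}low := low 2 four0'.
  have exc : - ln (eta / 3 * c0 / (k0 / (sigma * 2))) <= excess m 2 / 2.
    have lnL : 0 <= ln (L m) by apply: ln_ge0; lra.
    have : - ln (eta / 3 * c0 / (k0 / (sigma * 2))) <= L m by near: m; exact: L_ge.
    rewrite /excess; lra.
  have dfc : c0 <= df m by near: m.
  have kp : 0 < k0 / (sigma * 2) by rewrite divr_gt0// mulr_gt0.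
  have argp : eta / 3 * c0 / (k0 / (sigma * 2)) \is Num.pos.
    by rewrite posrE divr_gt0// mulr_gt0.
  have ex : expR (- (excess m 2 / 2)) <= eta / 3 * c0 / (k0 / (sigma * 2)).
    by rewrite -[leRHS](lnK argp) ler_expR lerNl.
  have : c0 * Q (2 * Num.sqrt (L m)) <= s m * (eta / 3 * c0).
    apply: (@le_trans _ _ (df m * Q (2 * Num.sqrt (L m)))).
      by apply: ler_wpM2r => //; exact: normal_tail_ge0.
    apply: (le_trans low); rewrite -mulrA ler_pM2l// mulrC.
    by rewrite -ler_pdivlMr.
  have -> : s m * (eta / 3 * c0) = c0 * (eta / 3 * s m) by ring.
  by rewrite ler_pM2l.
lra.
Unshelve. all: end_near. Qed.

(** A rule with a threshold beyond [(1 + j) * s] accepts an additional stretch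
    of effects, which carries a mass of order [s]. *)
Lemma type2_gain : exists2 j0, 0 < j0 & forall j, 0 < j -> j <= j0 ->
  exists2 c, 0 < c & exists2 k, 0 < k < 1 &
  \forall m \near \oo, forall x y,
    x <= - ((1 - k) * s m) -> (1 - k) * s m <= y ->
    x <= - ((1 + j) * s m) \/ (1 + j) * s m <= y ->
    seg (- s m) (s m) + c * s m <= type2_error nu (e m) x y.
Proof.
have [_ [j0 j00 hj] /(_ 1 ltr01)[K K0 hK] _] := nu_regular.
exists j0 => // j jp jj0.
have [|||c c_gt0 hc] := hj (j / 4) (j / 2); try by lra.
have cK : 0 < c + K by rewrite addr_gt0.
have four0 : 0 < 4 :> R by [].
have c4 : 0 < c / 4 by rewrite divr_gt0.
have [k /andP[k_gt0 k4] hk] := sandwich c4.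
(* A margin of [k' * s] for the noise keeps both the segment of the factor
   [1 - k] and the stretch from [1 + j / 4] to [1 + j / 2] accepted. *)
pose k' := Num.min (k / 2) (j / 4).
have k'0 : 0 < k' by rewrite lt_min !divr_gt0.
have k'k : k' <= k / 2 by rewrite ge_min lexx.
have k'j : k' <= j / 4 by rewrite ge_min lexx orbT.
clearbody k'.
exists (c / 4); first by rewrite divr_gt0.
exists k'; first by apply/andP; split; lra.
near=> m => x y xk yk xyj.
have sm : 0 < s m by near: m; exact: s_gt0.
have ks : 0 < k * s m by rewrite mulr_gt0.
have k's : 0 < k' * s m by rewrite mulr_gt0.
have js : 0 < j * s m by rewrite mulr_gt0.
have ks4 : k * s m <= 4^-1 * s m by rewrite ler_pM2r.
have k'ks : k' * s m <= k / 2 * s m by rewrite ler_pM2r.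
have k'js : k' * s m <= j / 4 * s m by rewrite ler_pM2r.
have km : seg (- s m) (s m) <= seg (- ((1 - k) * s m)) ((1 - k) * s m) + c / 4 * s m.
  suff : seg (- ((1 + k) * s m)) ((1 + k) * s m) <= seg (- s m) (s m) + c / 4 * s m /\
    seg (- s m) (s m) <= seg (- ((1 - k) * s m)) ((1 - k) * s m) + c / 4 * s m.
    by case.
  by near: m.
have [cr cl] : c * s m <= seg ((1 + j / 4) * s m) ((1 + j / 2) * s m) /\
    c * s m <= seg (- ((1 + j / 2) * s m)) (- ((1 + j / 4) * s m)) by near: m.
have Km : seg (- (1 * s m)) (1 * s m) <= K * s m by near: m.
have qK : Q (k' * Num.sqrt (L m)) <= c / (4 * (c + K)).
  by near: m; apply: tail_small; [exact: k'0|apply: divr_gt0; [exact: c_gt0|apply: mulr_gt0; [exact: four0|exact: cK]]].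
have xy : x < y by lra.
have mar : forall x y, x < y ->
    seg (x + k' * s m) (y - k' * s m) * (1 - 2 * Q (k' * Num.sqrt (L m)))
    <= type2_error nu (e m) x y.
  by near: m; exact: type2_margin.
set q := Q (k' * Num.sqrt (L m)) in qK mar.
have q0 : 0 <= q by exact: normal_tail_ge0.
have {}mar := mar _ _ xy.
set A := seg (- ((1 - k) * s m)) ((1 - k) * s m) in km.
have A0 : 0 <= A by exact: seg_mass_ge0.
have AK : A <= K * s m by apply: le_trans Km; apply: seg_mass_le; lra.
have AB : A + c * s m <= seg (x + k' * s m) (y - k' * s m).
  case: xyj => [xj|yj].
    apply: (@le_trans _ _ (seg (- ((1 + j / 2) * s m)) (- ((1 + j / 4) * s m)) + A)).
      by rewrite addrC lerD2r.
    apply: (@le_trans _ _ (seg (- ((1 + j / 2) * s m)) ((1 - k) * s m))).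
      by apply: seg_mass_disjoint_le; lra.
    by apply: seg_mass_le; lra.
  apply: (@le_trans _ _ (A + seg ((1 + j / 4) * s m) ((1 + j / 2) * s m))).
    by rewrite lerD2l.
  apply: (@le_trans _ _ (seg (- ((1 - k) * s m)) ((1 + j / 2) * s m))).
    by apply: seg_mass_disjoint_le; lra.
  by apply: seg_mass_le; lra.
have qc : q * (4 * (c + K)) <= c by rewrite -ler_pdivlMr// mulr_gt0.
have q4 : q * (4 * (c + K)) * s m <= c * s m by rewrite ler_pM2r.
have qA : q * (A + c * s m) <= q * ((c + K) * s m).
  by apply: ler_wpM2l => //; lra.
have q1 : 2 * q <= 1.
  have : q * (4 * (c + K)) <= 4^-1 * (4 * (c + K)) by lra.
  by rewrite ler_pM2r ?mulr_gt0//; lra.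
have : (A + c * s m) * (1 - 2 * q)
    <= seg (x + k' * s m) (y - k' * s m) * (1 - 2 * q).
  by apply: ler_wpM2r => //; rewrite subr_ge0.
lra.
Unshelve. all: end_near. Qed.

Local Notation cost m u w := (test_cost nu (df m) (e m) u w).

Lemma cost_parts : \forall m \near \oo, forall u w, u < 0 -> 0 < w ->
  cost m u w = df m * Q (- u / s m * Num.sqrt (L m))
               + df m * Q (w / s m * Num.sqrt (L m)) + type2_error nu (e m) u w.
Proof.
near=> m => u w u0 w0.
have em : 0 < e m by near: m.
have L1 : 1 <= L m by near: m; exact: L_ge.
have t0 : 0 < Num.sqrt (L m) by rewrite sqrtr_gt0; lra.
have scale z : z / s m * Num.sqrt (L m) = z / e m.
  have -> : s m = e m * Num.sqrt (L m) by near: m.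
  by field; rewrite !gt_eqF.
by rewrite test_cost.unlock type1E ?(lt_trans u0)// !scale mulrDr.
Unshelve. all: end_near. Qed.

Lemma seg_le_scale : exists2 K, 0 < K &
  \forall m \near \oo, seg (- s m) (s m) <= K * s m.
Proof.
have [_ _ /(_ 1 ltr01)[K K0 hK] _] := nu_regular; exists K => //.
by apply: filterS hK => m; rewrite mul1r.
Qed.

Lemma df_tail_ge0 : \forall m \near \oo, forall b, 0 <= df m * Q b.
Proof.
near=> m => b; apply: mulr_ge0; last exact: normal_tail_ge0.
by apply: (le_trans (ltW c0_gt0)); near: m.
Unshelve. all: end_near. Qed.

Lemma cheap_thresholds (k B : R) : 0 < k < 1 -> \forall m \near \oo,
  forall u w, u < 0 -> 0 < w -> cost m u w <= B * s m ->
  u <= - ((1 - k) * s m) /\ (1 - k) * s m <= w.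
Proof.
move=> k01; near=> m => u w u0 w0 cB.
have sm : 0 < s m by near: m; exact: s_gt0.
have em : 0 < e m by near: m.
have low : forall b, b < 1 - k -> B * s m < df m * Q (b * Num.sqrt (L m)).
  by near: m; exact: type1_low_threshold.
have parts : forall u w, u < 0 -> 0 < w ->
  cost m u w = df m * Q (- u / s m * Num.sqrt (L m))
               + df m * Q (w / s m * Num.sqrt (L m)) + type2_error nu (e m) u w.
  by near: m; exact: cost_parts.
rewrite parts// in cB.
have pos : forall b, 0 <= df m * Q b by near: m; exact: df_tail_ge0.
have p1 := pos (- u / s m * Num.sqrt (L m)).
have p2 := pos (w / s m * Num.sqrt (L m)).
have p3 := type2_ge0 nu em u w.
split.
  rewrite lerNr -ler_pdivlMr// leNgt; apply/negP => /low; lra.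
rewrite -ler_pdivlMr// leNgt; apply/negP => /low; lra.
Unshelve. all: end_near. Qed.

(** A rule that is not cheap satisfies the bound trivially; the thresholds of a
    cheap one are at least [(1 - k) * s] in absolute value, and then the type II
    error alone is large enough. *)
Lemma cost_lower_bound (eta : R) : 0 < eta -> \forall m \near \oo,
  forall u w, u < 0 -> 0 < w -> seg (- s m) (s m) - eta * s m <= cost m u w.
Proof.
move=> eta0; have [k k01 hk] := type2_lower_bound eta0.
have [K K0 hK] := seg_le_scale.
near=> m => u w u0 w0.
have sm : 0 < s m by near: m; exact: s_gt0.
have Km : seg (- s m) (s m) <= K * s m by near: m.
have es : 0 < eta * s m by rewrite mulr_gt0.
have [cK|Kc] := leP (cost m u w) (K * s m); last by lra.
have thr : forall u w, u < 0 -> 0 < w -> cost m u w <= K * s m ->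
  u <= - ((1 - k) * s m) /\ (1 - k) * s m <= w.
  by near: m; exact: cheap_thresholds.
have [uk wk] := thr _ _ u0 w0 cK.
have t2 : forall x y, x <= - ((1 - k) * s m) -> (1 - k) * s m <= y ->
    seg (- s m) (s m) - eta * s m <= type2_error nu (e m) x y by near: m.
have parts : forall u w, u < 0 -> 0 < w ->
  cost m u w = df m * Q (- u / s m * Num.sqrt (L m))
               + df m * Q (w / s m * Num.sqrt (L m)) + type2_error nu (e m) u w.
  by near: m; exact: cost_parts.
have pos : forall b, 0 <= df m * Q b by near: m; exact: df_tail_ge0.
have p1 := pos (- u / s m * Num.sqrt (L m)).
have p2 := pos (w / s m * Num.sqrt (L m)).
have p3 := t2 _ _ uk wk.
rewrite parts//; lra.
Unshelve. all: end_near. Qed.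

Lemma cost_upper_bound (eta : R) : 0 < eta -> exists k A, 0 < k /\
  \forall m \near \oo, forall u w, u < 0 -> 0 < w ->
    2^-1 <= - u / s m <= 1 + k -> A <= excess m (- u / s m) ->
    2^-1 <= w / s m <= 1 + k -> A <= excess m (w / s m) ->
    cost m u w <= seg (- s m) (s m) + eta * s m.
Proof.
move=> eta0; have eta3 : 0 < eta / 3 by rewrite divr_gt0.
have [k /andP[k_gt0 _] hk] := type2_upper_bound eta3.
have [A hA] := type1_large_excess eta3.
exists k, A; split=> //; near=> m => u w u0 w0 /andP[ul ur] uA /andP[wl wr] wA.
have sm : 0 < s m by near: m; exact: s_gt0.
have t1 : forall b, 2^-1 <= b -> A <= excess m b ->
    df m * Q (b * Num.sqrt (L m)) <= eta / 3 * s m by near: m.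
have t2 : forall x y, - ((1 + k) * s m) <= x -> x < y -> y <= (1 + k) * s m ->
    type2_error nu (e m) x y <= seg (- s m) (s m) + eta / 3 * s m by near: m.
have parts : forall u w, u < 0 -> 0 < w ->
  cost m u w = df m * Q (- u / s m * Num.sqrt (L m))
               + df m * Q (w / s m * Num.sqrt (L m)) + type2_error nu (e m) u w.
  by near: m; exact: cost_parts.
have p1 := t1 _ ul uA; have p2 := t1 _ wl wA.
have uk : - ((1 + k) * s m) <= u by rewrite lerNl -ler_pdivrMr.
have wk : w <= (1 + k) * s m by rewrite -ler_pdivrMr.
have p3 := t2 _ _ uk (lt_trans u0 w0) wk.
rewrite parts//; lra.
Unshelve. all: end_near. Qed.

Lemma lnL_ge (A : R) : \forall m \near \oo, A <= ln (L m).
Proof.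
near=> m; have LA : expR A <= L m by near: m; exact: L_ge.
have L0 : L m \is Num.pos by rewrite posrE (lt_le_trans (expR_gt0 A)).
by rewrite -(lnK L0) ler_expR in LA.
Unshelve. all: end_near. Qed.

(** By [cost_lower_bound] no rule has a cost below [seg (- s) s - o(s)], so that
    this says that the cost is optimal up to [o(s)]. *)
Definition near_optimal (x y : nat -> R) : Prop := forall eta, 0 < eta ->
  \forall m \near \oo, cost m (x m) (y m) <= seg (- s m) (s m) + eta * s m.

Section comparison.
Variables xo yo : nat -> R.
Hypothesis oracle_sign : \forall m \near \oo, xo m < 0 < yo m.
Hypothesis oracle_opt : \forall m \near \oo, forall u w, u < 0 -> 0 < w ->
  cost m (xo m) (yo m) <= cost m u w.

(** The oracle is not worse than the rule with the thresholds [- s] and [s],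
    whose excess is [2 log L] and which is therefore near-optimal. *)
Lemma oracle_near_optimal : near_optimal xo yo.
Proof.
move=> eta eta0; have [k [A [k_gt0 hk]]] := cost_upper_bound eta0.
near=> m; have sm : 0 < s m by near: m; exact: s_gt0.
have opt : forall u w, u < 0 -> 0 < w -> cost m (xo m) (yo m) <= cost m u w.
  by near: m.
have sN : - s m < 0 by rewrite oppr_lt0.
apply: (le_trans (opt _ _ sN sm)).
have up : forall u w, u < 0 -> 0 < w ->
    2^-1 <= - u / s m <= 1 + k -> A <= excess m (- u / s m) ->
    2^-1 <= w / s m <= 1 + k -> A <= excess m (w / s m) ->
    cost m u w <= seg (- s m) (s m) + eta * s m by near: m.
have ss : s m / s m = 1 by rewrite divff// gt_eqF.
have lnA : A <= ln (L m) by near: m; exact: lnL_ge.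
have ln0 : 0 <= ln (L m) by near: m; exact: lnL_ge.
have ex : A <= excess m 1 by rewrite /excess expr1n subrr mulr0 add0r; lra.
have one : 2^-1 <= (1 : R) <= 1 + k by apply/andP; split; lra.
by apply: up; rewrite ?opprK ?ss.
Unshelve. all: end_near. Qed.

(** The optimal cost is of the exact order [s], so a ratio tending to 1 means a
    difference of [o(s)]. *)
Lemma ratio_cvg1_near_optimal (x y : nat -> R) :
  (forall m, x m < 0 < y m) ->
  (cost m (x m) (y m) / cost m (xo m) (yo m)) @[m --> \oo] --> (1 : R)
  <-> near_optimal x y.
Proof.
move=> xy; have [_ _ _ [c c_gt0 hc]] := nu_regular.
have [K K0 hK] := seg_le_scale.
have c2 : 0 < c / 2 by rewrite divr_gt0.
split=> [ratio1 eta eta0|opt].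
  (* With [co <= (K + eta / 4) * s], where [co] is the cost of the oracle, a
     ratio of at most [1 + th / 2] leaves an error of at most [eta * s]. *)
  pose th := Num.min 1 (eta / (2 * K + eta)).
  have d0 : 0 < 2 * K + eta by rewrite addr_gt0// mulr_gt0.
  have th0 : 0 < th by rewrite lt_min ltr01 divr_gt0.
  have thK : th * (2 * K + eta) <= eta.
    by rewrite -ler_pdivlMr// ge_min lexx orbT.
  have th1 : th <= 1 by rewrite ge_min lexx.
  clearbody th.
  have eta4 : 0 < eta / 4 by rewrite divr_gt0.
  near=> m; have sm : 0 < s m by near: m; exact: s_gt0.
  have cm : c * s m <= seg (- s m) (s m) by near: m.
  have Km : seg (- s m) (s m) <= K * s m by near: m.
  have um : cost m (xo m) (yo m) <= seg (- s m) (s m) + eta / 4 * s m.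
    by near: m; exact: oracle_near_optimal.
  have lower : forall u w, u < 0 -> 0 < w ->
    seg (- s m) (s m) - c / 2 * s m <= cost m u w.
    by near: m; exact: cost_lower_bound.
  have /andP[xo0 yo0] : xo m < 0 < yo m by near: m.
  have lm := lower _ _ xo0 yo0.
  have cs : 0 < c * s m by rewrite mulr_gt0.
  have rm : cost m (x m) (y m) / cost m (xo m) (yo m) <= 1 + th / 2.
    near: m; apply: (cvgr_le 1) => //; lra.
  move: cm Km um lm rm; move: (cost m (x m) (y m)) (cost m (xo m) (yo m))
    (seg (- s m) (s m)) => cx co h cm Km um lm.
  have co0 : 0 < co by lra.
  rewrite ler_pdivrMr// => rm.
  have e1 : (1 + th / 2) * co <= (1 + th / 2) * (h + eta / 4 * s m).
    by apply: ler_wpM2l => //; lra.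
  have e2 : th * h <= th * (K * s m) by rewrite ler_pM2l.
  have e3 : th * (2 * K + eta) * s m <= eta * s m by rewrite ler_pM2r.
  have e4 : 0 < eta * s m by rewrite mulr_gt0.
  have e5 : 0 < th * (eta * s m) by rewrite mulr_gt0.
  lra.
apply/cvgrPdist_le => eps eps0.
pose eta := Num.min (c / 2) (eps * c / 4).
have eta0 : 0 < eta by rewrite lt_min c2 divr_gt0// mulr_gt0.
have eta_c : eta <= c / 2 by rewrite ge_min lexx.
have eta_e : eta <= eps * c / 4 by rewrite ge_min lexx orbT.
clearbody eta.
near=> m; have sm : 0 < s m by near: m; exact: s_gt0.
have cm : c * s m <= seg (- s m) (s m) by near: m.
have [u1 u2] : cost m (xo m) (yo m) <= seg (- s m) (s m) + eta * s m /\
    cost m (x m) (y m) <= seg (- s m) (s m) + eta * s m.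
  split; near: m; first exact: oracle_near_optimal.
  exact: (opt _ eta0).
have lower : forall u w, u < 0 -> 0 < w ->
  seg (- s m) (s m) - eta * s m <= cost m u w.
  by near: m; exact: cost_lower_bound.
have /andP[xo0 yo0] : xo m < 0 < yo m by near: m.
have /andP[x0 y0] := xy m.
have l1 := lower _ _ xo0 yo0; have l2 := lower _ _ x0 y0.
have cs : 0 < c * s m by rewrite mulr_gt0.
have es : eta * s m <= c / 2 * s m by rewrite ler_pM2r.
have es2 : eta * s m <= eps * c / 4 * s m by rewrite ler_pM2r.
move: u1 u2 l1 l2 cm {lower}; move: (cost m (x m) (y m)) (cost m (xo m) (yo m))
  (seg (- s m) (s m)) => cx co h u1 u2 l1 l2 cm.
have co_ge : c / 2 * s m <= co by lra.
have co0 : 0 < co by lra.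
have -> : 1 - cx / co = (co - cx) / co by rewrite mulrBl divff// gt_eqF.
rewrite normrM normfV [X in _ / X]gtr0_norm// ler_pdivrMr//.
have : eps * (c / 2 * s m) <= eps * co by rewrite ler_pM2l.
by rewrite ler_norml => eco; apply/andP; split; lra.
Unshelve. all: end_near. Qed.

End comparison.

(** The type II error is at least [seg (- s) s - o(s)], so a near-optimal rule
    can spend only [o(s)] on type I errors, which is the growth of the excess,
    and can gain nothing of order [s] in type II errors, which is the upper bound
    on the thresholds. *)
Lemma near_optimal_thresholds (x y : nat -> R) : (forall m, x m < 0 < y m) ->
  near_optimal x y <->
  [/\ forall k, 0 < k -> \forall m \near \oo, - x m / s m <= 1 + k,
      forall k, 0 < k -> \forall m \near \oo, y m / s m <= 1 + k,
      forall A, \forall m \near \oo, A <= excess m (- x m / s m) &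
      forall A, \forall m \near \oo, A <= excess m (y m / s m)].
Proof.
move=> xy; have [K K0 hK] := seg_le_scale.
split=> [opt|[xk yk xA yA] eta eta0].
  have cheap k : 0 < k < 1 -> \forall m \near \oo,
      x m <= - ((1 - k) * s m) /\ (1 - k) * s m <= y m.
    move=> k01; near=> m.
    have sm : 0 < s m by near: m; exact: s_gt0.
    have Km : seg (- s m) (s m) <= K * s m by near: m.
    have um : cost m (x m) (y m) <= seg (- s m) (s m) + 1 * s m.
      by near: m; exact: (opt _ ltr01).
    have thr : forall u w, u < 0 -> 0 < w -> cost m u w <= (K + 1) * s m ->
      u <= - ((1 - k) * s m) /\ (1 - k) * s m <= w.
      by near: m; exact: cheap_thresholds.
    by have /andP[x0 y0] := xy m; apply: thr => //; lra.
  have upper k : 0 < k -> \forall m \near \oo,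
      - x m / s m <= 1 + k /\ y m / s m <= 1 + k.
    move=> k_gt0; have [j0 j00 gain] := type2_gain.
    pose j := Num.min j0 k.
    have j_gt0 : 0 < j by rewrite lt_min j00.
    have jj0 : j <= j0 by rewrite ge_min lexx.
    have jk : j <= k by rewrite ge_min lexx orbT.
    have [c c_gt0 [l l01 hl]] := gain j j_gt0 jj0.
    have c2 : 0 < c / 2 by rewrite divr_gt0.
    near=> m; have sm : 0 < s m by near: m; exact: s_gt0.
    have um : cost m (x m) (y m) <= seg (- s m) (s m) + c / 2 * s m.
      by near: m; exact: (opt _ c2).
    have [xl yl] : x m <= - ((1 - l) * s m) /\ (1 - l) * s m <= y m.
      by near: m; exact: cheap.
    have gm : forall x y, x <= - ((1 - l) * s m) -> (1 - l) * s m <= y ->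
        x <= - ((1 + j) * s m) \/ (1 + j) * s m <= y ->
        seg (- s m) (s m) + c * s m <= type2_error nu (e m) x y by near: m.
    have {}gm := gm _ _ xl yl.
    have parts : forall u w, u < 0 -> 0 < w ->
      cost m u w = df m * Q (- u / s m * Num.sqrt (L m))
                   + df m * Q (w / s m * Num.sqrt (L m)) + type2_error nu (e m) u w.
      by near: m; exact: cost_parts.
    have /andP[x0 y0] := xy m; rewrite parts// in um.
    have pos : forall b, 0 <= df m * Q b by near: m; exact: df_tail_ge0.
    have p1 := pos (- x m / s m * Num.sqrt (L m)).
    have p2 := pos (y m / s m * Num.sqrt (L m)).
    have cs : 0 < c * s m by rewrite mulr_gt0.
    have js : j * s m <= k * s m by rewrite ler_pM2r.
    split; rewrite ler_pdivrMr// leNgt; apply/negP => h.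
      have : seg (- s m) (s m) + c * s m <= type2_error nu (e m) (x m) (y m).
        by apply: gm; left; lra.
      lra.
    have : seg (- s m) (s m) + c * s m <= type2_error nu (e m) (x m) (y m).
      by apply: gm; right; lra.
    lra.
  have exc A : \forall m \near \oo,
      A <= excess m (- x m / s m) /\ A <= excess m (y m / s m).
    have [eta eta0 heta] := type1_small_excess A.
    have eta2 : 0 < eta / 2 by rewrite divr_gt0.
    have [k k01 hk] := type2_lower_bound eta2.
    near=> m; have sm : 0 < s m by near: m; exact: s_gt0.
    have um : cost m (x m) (y m) <= seg (- s m) (s m) + eta / 2 * s m.
      by near: m; exact: (opt _ eta2).
    have [xl yl] : x m <= - ((1 - k) * s m) /\ (1 - k) * s m <= y m.
      by near: m; exact: cheap.
    have lm : forall x y, x <= - ((1 - k) * s m) -> (1 - k) * s m <= y ->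
      seg (- s m) (s m) - eta / 2 * s m <= type2_error nu (e m) x y by near: m.
    have {}lm := lm _ _ xl yl.
    have sme : forall b, 0 < b ->
      df m * Q (b * Num.sqrt (L m)) <= eta * s m -> A <= excess m b by near: m.
    have parts : forall u w, u < 0 -> 0 < w ->
      cost m u w = df m * Q (- u / s m * Num.sqrt (L m))
                   + df m * Q (w / s m * Num.sqrt (L m)) + type2_error nu (e m) u w.
      by near: m; exact: cost_parts.
    have /andP[x0 y0] := xy m; rewrite parts// in um.
    have pos : forall b, 0 <= df m * Q b by near: m; exact: df_tail_ge0.
    have p1 := pos (- x m / s m * Num.sqrt (L m)).
    have p2 := pos (y m / s m * Num.sqrt (L m)).
    split; apply: sme; try lra.
      by rewrite divr_gt0// oppr_gt0.
    by rewrite divr_gt0.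
  split.
  - by move=> k /upper; apply: filterS => m [].
  - by move=> k /upper; apply: filterS => m [].
  - by move=> A; apply: filterS (exc A) => m [].
  - by move=> A; apply: filterS (exc A) => m [].
have [k [A [k_gt0 hk]]] := cost_upper_bound eta0.
(* Below [s / 2] the excess is at most [2 log L - (3 / 4) * L], which is
   negative for large [L]. *)
have half (b : nat -> R) : (forall m, 0 < s m -> 0 < b m) ->
    (\forall m \near \oo, 0 <= excess m (b m)) -> \forall m \near \oo, 2^-1 <= b m.
  move=> b0 bex; near=> m.
  have sm : 0 < s m by near: m; exact: s_gt0.
  have bm := b0 _ sm.
  have exm : 0 <= excess m (b m) by near: m.
  have L1 : 1 <= L m by near: m; exact: L_ge.
  have Lp : L m \is Num.pos by rewrite posrE; lra.
  have ln8 : 16 <= ln (L m) by near: m; exact: lnL_ge.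
  have lnL : ln (L m) ^+ 2 / 4 <= L m.
    by rewrite -[leRHS](lnK Lp); apply: expR_ge_sqr; lra.
  have lnL2 : 2 * ln (L m) <= ln (L m) ^+ 2 / 8 by rewrite expr2; nra.
  rewrite leNgt; apply/negP => bh.
  have b4 : b m ^+ 2 <= 4^-1 by rewrite expr2; nra.
  have Lb : L m * b m ^+ 2 <= L m * 4^-1 by apply: ler_wpM2l => //; lra.
  move: exm; rewrite /excess; lra.
have xh : \forall m \near \oo, 2^-1 <= - x m / s m.
  apply: half => // m sm; have /andP[x0 _] := xy m.
  by rewrite divr_gt0// oppr_gt0.
have yh : \forall m \near \oo, 2^-1 <= y m / s m.
  by apply: half => // m sm; have /andP[_ y0] := xy m; rewrite divr_gt0.
near=> m; have /andP[x0 y0] := xy m.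
have up : forall u w, u < 0 -> 0 < w ->
    2^-1 <= - u / s m <= 1 + k -> A <= excess m (- u / s m) ->
    2^-1 <= w / s m <= 1 + k -> A <= excess m (w / s m) ->
    cost m u w <= seg (- s m) (s m) + eta * s m by near: m.
apply: up => //.
- by apply/andP; split; near: m; [exact: xh|exact: xk].
- by near: m; exact: xA.
- by apply/andP; split; near: m; [exact: yh|exact: yk].
- by near: m; exact: yA.
Unshelve. all: end_near. Qed.

(** As [log L = o(L)], an excess that is bounded below already gives
    [z >= - o(L)]; the upper bound on the threshold is the other half of
    [z = o(L)]. *)
Lemma threshold_conditions (z b : nat -> R) :
  (forall m, 0 < s m -> 0 < b m) ->
  (\forall m \near \oo, z m = L m * (b m ^+ 2 - 1)) ->
  (forall k, 0 < k -> \forall m \near \oo, b m <= 1 + k) /\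
  (forall A, \forall m \near \oo, A <= excess m (b m))
  <-> z =o_\oo L /\ (z m + 2 * ln (L m)) @[m --> \oo] --> +oo.
Proof.
move=> b0 zE.
have sqr_le (t k : R) : 0 < k -> t ^+ 2 - 1 <= k -> t <= 1 + k.
  by move=> k_gt0; rewrite expr2 leNgt => h; apply/negP => kt; nra.
have exE : \forall m \near \oo, z m + 2 * ln (L m) = excess m (b m).
  by near=> m; rewrite /excess; congr (_ + _); near: m.
split=> [[bk bA]|[zo zy]]; split.
- apply/eqoP => eps eps0; near=> m.
  pose k := Num.min 1 (eps / 3).
  have L1 : 1 <= L m by near: m; exact: L_ge.
  rewrite [X in _ * X]ger0_norm; last by lra.
  have -> : z m = L m * (b m ^+ 2 - 1) by near: m.
  have sm : 0 < s m by near: m; exact: s_gt0.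
  have bm := b0 _ sm.
  have bk1 : b m <= 1 + Num.min 1 (eps / 3).
    by near: m; apply: bk; rewrite lt_min ltr01 divr_gt0.
  have kle1 : k <= 1 by rewrite ge_min lexx.
  have k3 : k <= eps / 3 by rewrite ge_min lexx orbT.
  rewrite -/k in bk1; clearbody k.
  have b2 : b m ^+ 2 - 1 <= eps by rewrite expr2; nra.
  have ex0 : 0 <= excess m (b m) by near: m; exact: bA.
  have Lp : L m \is Num.pos by rewrite posrE; lra.
  have ln1 : 16 / eps + 1 <= ln (L m) by near: m; exact: lnL_ge.
  have ie : 0 < 16 / eps by rewrite divr_gt0.
  have lnL : ln (L m) ^+ 2 / 4 <= L m.
    by rewrite -[leRHS](lnK Lp); apply: expR_ge_sqr; lra.
  have lne : 16 <= eps * ln (L m).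
    rewrite mulrC -ler_pdivrMr//; lra.
  have lnl : 2 * ln (L m) <= eps * L m.
    apply: (@le_trans _ _ (eps * (ln (L m) ^+ 2 / 4))); last by rewrite ler_pM2l.
    have -> : eps * (ln (L m) ^+ 2 / 4) = eps * ln (L m) * (ln (L m) / 4) by field.
    by nra.
  rewrite normrM ger0_norm; last by lra.
  rewrite mulrC ler_pM2r; last by lra.
  rewrite ler_norml b2 andbT.
  move: ex0; rewrite /excess => ex0.
  have : - eps * L m <= (b m ^+ 2 - 1) * L m by lra.
  by rewrite ler_pM2r//; lra.
- apply/cvgryPge => A; near=> m.
  have -> : z m + 2 * ln (L m) = excess m (b m) by near: m.
  by near: m; exact: bA.
- move=> k k_gt0; have /eqoP/(_ k k_gt0) zok := zo.
  near=> m; have L1 : 1 <= L m by near: m; exact: L_ge.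
  have sm : 0 < s m by near: m; exact: s_gt0.
  have bm := b0 _ sm.
  have : `|z m| <= k * `|L m| by near: m; exact: zok.
  have -> : z m = L m * (b m ^+ 2 - 1) by near: m.
  have L0 : 0 < L m := lt_le_trans ltr01 L1.
  rewrite (ger0_norm (ltW L0)) => /(le_trans (ler_norm _)).
  by rewrite mulrC ler_pM2r// => /(sqr_le _ _ k_gt0).
- move=> A; near=> m.
  have <- : z m + 2 * ln (L m) = excess m (b m) by near: m.
  by near: m; exact: (cvgry_ge zy).
Unshelve. all: end_near. Qed.

End asymptotics.

(** * The threshold scale *)

Section scale.
Context {R : realType}.
Variables (n : nat -> nat) (df v : nat -> R) (c : \bar R) (C : R).
Hypothesis A : assumptionA n df c C.
Hypothesis vE : forall m, v m = (n m)%:R * df m ^+ 2.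

Lemma sample_size_cvg : (n m)%:R @[m --> \oo] --> (+oo : set_system R).
Proof. by case: A => nA _ _ _ _; exact/cvgrnyP. Qed.

Lemma weight_ge : exists2 c0, 0 < c0 & \forall m \near \oo, c0 <= df m.
Proof.
case: A => _ c_gt0 dfc _ _.
have [r r0 rc] : exists2 r : R, 0 < r & (r%:E < c)%E.
  case: c c_gt0 {dfc} => [r|_|//].
    rewrite lte_fin => r0; exists (r / 2); first by rewrite divr_gt0.
    by rewrite lte_fin ltr_pdivrMr// ltr_pMr// ltr1n.
  by exists 1 => //; rewrite ltry.
exists r => //.
have : \forall m \near \oo, (r%:E < (df m)%:E)%E.
  exact: (dfc [set y | (r%:E < y)%E] (open_ereal_gt' rc)).
by apply: filterS => m; rewrite lte_fin => /ltW.
Qed.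

Lemma log_v_cvg : ln (v m) @[m --> \oo] --> +oo.
Proof.
have [c0 c00 hc0] := weight_ge.
apply/cvgryPge => B; near=> m.
have c0m : c0 <= df m by near: m.
have nm : expR B / c0 ^+ 2 <= (n m)%:R.
  by near: m; exact: (cvgry_ge sample_size_cvg).
have c02 : c0 ^+ 2 <= df m ^+ 2.
  by rewrite ler_sqr ?nnegrE ?(ltW c00)// (le_trans (ltW c00)).
have vB : expR B <= v m.
  rewrite vE; apply: (@le_trans _ _ ((n m)%:R * c0 ^+ 2)).
    by rewrite -ler_pdivrMr// exprn_gt0.
  exact: ler_wpM2l.
have vp : v m \is Num.pos by rewrite posrE (lt_le_trans (expR_gt0 B)).
by rewrite -ler_expR (lnK vp).
Unshelve. all: end_near. Qed.

(** [log v / n] is the sum of [log n / n], which vanishes, and of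
    [2 * log (delta f) / n]. *)
Lemma log_v_over_n_cvg : (ln (v m) / (n m)%:R) @[m --> \oo] --> C.
Proof.
have [c0 c00 hc0] := weight_ge.
have lnn : (ln (n m)%:R / (n m)%:R : R) @[m --> \oo] --> (0 : R).
  apply/cvgr0Pnorm_le => eps eps0; near=> m.
  have n1 : 1 <= (n m)%:R :> R by near: m; exact: (cvgry_ge sample_size_cvg).
  have n2 : expR (4 / eps) <= (n m)%:R by near: m; exact: (cvgry_ge sample_size_cvg).
  have np : (n m)%:R \is @Num.pos R by rewrite posrE (lt_le_trans ltr01).
  have l0 : 0 <= ln (n m)%:R :> R by exact: ln_ge0.
  have l4 : 4 / eps <= ln (n m)%:R by rewrite -ler_expR (lnK np).
  have ln2 : ln (n m)%:R ^+ 2 / 4 <= (n m)%:R :> R.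
    by rewrite -[leRHS](lnK np); exact: expR_ge_sqr.
  rewrite ger0_norm; last by rewrite divr_ge0.
  rewrite ler_pdivrMr ?(lt_le_trans ltr01)//.
  apply: (@le_trans _ _ (eps * (ln (n m)%:R ^+ 2 / 4))); last by rewrite ler_pM2l.
  have -> : eps * (ln (n m)%:R ^+ 2 / 4) = ln (n m)%:R * (ln (n m)%:R * eps / 4) by field.
  rewrite ler_peMr// ler_pdivlMr// mul1r.
  by rewrite -ler_pdivrMr.
have [_ _ _ _ lC] := A.
have : (ln (n m)%:R / (n m)%:R + 2 * ln (df m) / (n m)%:R : R) @[m --> \oo] --> (0 + C).
  exact: cvgD.
rewrite add0r; apply: cvg_trans; apply: near_eq_cvg; near=> m.
have c0m : c0 <= df m by near: m.
have n1 : 1 <= (n m)%:R :> R by near: m; exact: (cvgry_ge sample_size_cvg).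
have dp : 0 < df m by exact: lt_le_trans c0m.
have np : 0 < (n m)%:R :> R by exact: lt_le_trans n1.
rewrite -mulrDl vE lnM ?posrE ?exprn_gt0// lnXn//.
by rewrite mulr_natl.
Unshelve. all: end_near. Qed.

Variables (sigma : R).
Hypothesis sigma_gt0 : 0 < sigma.
Let e m := sigma / Num.sqrt (n m)%:R.
Let s m := sigma * Num.sqrt (ln (v m) / (n m)%:R).

Lemma noise_gt0 : \forall m \near \oo, 0 < e m.
Proof.
near=> m; have n1 : 1 <= (n m)%:R :> R by near: m; exact: (cvgry_ge sample_size_cvg).
by rewrite divr_gt0// sqrtr_gt0 (lt_le_trans ltr01).
Unshelve. all: end_near. Qed.

Lemma scaleE : \forall m \near \oo, s m = e m * Num.sqrt (ln (v m)).
Proof.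
near=> m; have l0 : 0 <= ln (v m) by near: m; exact: (cvgry_ge log_v_cvg).
by rewrite /s /e sqrtrM// sqrtrV// mulrA mulrAC.
Unshelve. all: end_near. Qed.

(** This is [v = n * df ^+ 2] in the form [expR (log v / 2) = sqrt n * df]. *)
Lemma weightE : \forall m \near \oo,
  df m * (sigma * Num.sqrt (ln (v m))) = s m * expR (ln (v m) / 2).
Proof.
have [c0 c00 hc0] := weight_ge.
near=> m.
have c0m : c0 <= df m by near: m.
have dp : 0 < df m by exact: lt_le_trans c0m.
have n1 : 1 <= (n m)%:R :> R by near: m; exact: (cvgry_ge sample_size_cvg).
have np : 0 < (n m)%:R :> R by exact: lt_le_trans n1.
have vp : v m \is Num.pos by rewrite posrE vE mulr_gt0// exprn_gt0.
have -> : expR (ln (v m) / 2) = Num.sqrt (n m)%:R * df m.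
  have -> : Num.sqrt (n m)%:R * df m = Num.sqrt (v m).
    by rewrite vE sqrtrM ?ltW// sqrtr_sqr gtr0_norm.
  rewrite -[in RHS](lnK vp) [in RHS](_ : ln (v m) = 2%:R * (ln (v m) / 2)); last by field.
  by rewrite expRM_natl sqrtr_sqr ger0_norm// expR_ge0.
have -> : s m = e m * Num.sqrt (ln (v m)) by near: m; exact: scaleE.
by rewrite /e; field; rewrite gt_eqF// sqrtr_gt0.
Unshelve. all: end_near. Qed.

(** The thresholds of order [s] converge to [T], so only the behaviour of the
    effect law near [- T] and [T] matters. *)
Lemma scale_cvg : s m @[m --> \oo] --> sigma * Num.sqrt C.
Proof.
apply: cvgMr; apply: (continuous_cvg _ (@sqrt_continuous R C)).
exact: log_v_over_n_cvg.
Qed.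

Lemma threshold_excess (x z : nat -> R) :
  (forall m, (n m)%:R * x m ^+ 2 / sigma ^+ 2 = ln (v m) + z m) ->
  \forall m \near \oo, z m = ln (v m) * ((x m / s m) ^+ 2 - 1).
Proof.
move=> zE; near=> m.
have n1 : 1 <= (n m)%:R :> R by near: m; exact: (cvgry_ge sample_size_cvg).
have np : 0 < (n m)%:R :> R by exact: lt_le_trans n1.
have l1 : 1 <= ln (v m) by near: m; exact: (cvgry_ge log_v_cvg).
have lp : 0 < ln (v m) by exact: lt_le_trans l1.
have -> : z m = (n m)%:R * x m ^+ 2 / sigma ^+ 2 - ln (v m) by rewrite zE addrC addKr.
rewrite expr_div_n /s exprMn sqr_sqrtr; last by rewrite divr_ge0 ?ltW.
by field; rewrite !gt_eqF.
Unshelve. all: end_near. Qed.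

End scale.

(** * The characterization of the optimal thresholds *)

Theorem theorem2p2 (R : realType)
    (sigma : R) (nu : probability (measurableTypeR R) R)
    (n : nat -> nat) (p delta0 deltaA : nat -> R)
    (d : nat -> measure_display) (Omega : forall m, measurableType (d m))
    (P : forall m, probability (Omega m) R)
    (mu : forall m, 'I_m -> {RV (P m) >-> R})
    (X : forall m, 'I_(n m) -> 'I_m -> {RV (P m) >-> R})
    (a b : nat -> R) (ta tb : nat -> R)
    (c : \bar R) (C : R) (v za zb : nat -> R) :
  let delta m := delta0 m / deltaA m in
  let f m := (1 - p m) / p m in
  let R_of m (x y : R) :=
    risk (P m) (delta0 m) (deltaA m) (@mu m) (interval_rule (@X m) x y) in
  0 < sigma ->
  admissible_effect_law nu ->
  (forall m, 0 < p m < 1) ->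
  (forall m, 0 < delta0 m) ->
  (forall m, 0 < deltaA m) ->
  (forall m, two_groups_model (p m) sigma nu (@mu m) (@X m)) ->
  (\forall m \near \oo,
     oracle_thresholds (n m) (p m) (delta0 m) (deltaA m) sigma nu (a m) (b m)) ->
  assumptionA n (fun m => delta m * f m) c C ->
  assumptionC nu sigma C ->
  (forall m, ta m < 0 < tb m) ->
  (forall m, v m = (n m)%:R * delta m ^+ 2 * f m ^+ 2) ->
  (forall m, (n m)%:R * ta m ^+ 2 / sigma ^+ 2 = ln (v m) + za m) ->
  (forall m, (n m)%:R * tb m ^+ 2 / sigma ^+ 2 = ln (v m) + zb m) ->
  ABOS (fun m => R_of m (ta m) (tb m)) (fun m => R_of m (a m) (b m)) <->
  [/\ za =o_\oo (fun m => ln (v m)),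
      zb =o_\oo (fun m => ln (v m)),
      (za m + 2 * ln (ln (v m))) @[m --> \oo] --> +oo &
      (zb m + 2 * ln (ln (v m))) @[m --> \oo] --> +oo].
Proof.
move=> delta f R_of sigma_gt0 [nu0 _ _] p01 d0 dA model oracle HA HC sgn vE zaE zbE.
pose df m := delta m * f m.
pose L m := ln (v m).
pose e m := sigma / Num.sqrt (n m)%:R.
pose s m := sigma * Num.sqrt (ln (v m) / (n m)%:R).
have vE' m : v m = (n m)%:R * df m ^+ 2 by rewrite vE -mulrA -exprMn.
have [c0 c0_gt0 df_ge] := weight_ge HA.
have L_cvg : L m @[m --> \oo] --> +oo by exact: (log_v_cvg HA vE').
have e_gt0 : \forall m \near \oo, 0 < e m by exact: (noise_gt0 HA sigma_gt0).
have sE : \forall m \near \oo, s m = e m * Num.sqrt (L m).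
  exact: (scaleE HA vE' sigma).
have dfE : \forall m \near \oo, df m * (sigma * Num.sqrt (L m)) = s m * expR (L m / 2).
  exact: (weightE HA vE' sigma).
have s_pos := s_gt0 L_cvg e_gt0 sE.
have C_ge0 : 0 <= C by case: HA.
have s_cvg : s m @[m --> \oo] --> sigma * Num.sqrt C by exact: (scale_cvg HA vE').
have reg : regular_at_scale nu s.
  exact: (assumptionC_regular sigma_gt0 C_ge0 HC s_pos s_cvg).
have n_pos : \forall m \near \oo, (0 < n m)%N.
  near=> m.
  have n1 : 1 <= (n m)%:R :> R by near: m; exact: (cvgry_ge (sample_size_cvg HA)).
  by rewrite -(ltr0n R) (lt_le_trans ltr01 n1).
have unit_gt0 m : 0 < deltaA m * p m by have /andP[] := p01 m => *; rewrite mulr_gt0.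
have weight_mul m : deltaA m * p m * df m = delta0 m * (1 - p m).
  have /andP[p0 _] := p01 m.
  by rewrite /df /delta /f; field; rewrite !gt_eqF.
have costE m x y : delta0 m * (1 - p m) * type1_error (e m) x y
      + deltaA m * p m * type2_error nu (e m) x y
    = deltaA m * p m * test_cost nu (df m) (e m) x y.
  by rewrite test_cost.unlock -weight_mul; ring.
have riskE : \forall m \near \oo, forall x y,
    R_of m x y = m%:R * (deltaA m * p m * test_cost nu (df m) (e m) x y).
  apply: filterS n_pos => m nm x y.
  by rewrite /R_of (risk_interval_rule _ _ _ _ (model m) sigma_gt0 nm nu0 (p01 m)) costE.
have oracle_sign : \forall m \near \oo, a m < 0 < b m.
  by apply: filterS oracle => m [-> ->].
have oracle_opt : \forall m \near \oo, forall u w, u < 0 -> 0 < w ->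
    test_cost nu (df m) (e m) (a m) (b m) <= test_cost nu (df m) (e m) u w.
  apply: filterS2 oracle n_pos => m om nm u w _ _.
  rewrite -(ler_pM2l (unit_gt0 m)) -!costE.
  exact: (oracle_interval_optimal sigma_gt0 nm u w (p01 m) (d0 m) (dA m) om).
have ratioE : {near \oo, (fun m => R_of m (ta m) (tb m) / R_of m (a m) (b m))
    =1 (fun m => test_cost nu (df m) (e m) (ta m) (tb m)
               / test_cost nu (df m) (e m) (a m) (b m))}.
  near=> m; have rE : forall x y, R_of m x y
      = m%:R * (deltaA m * p m * test_cost nu (df m) (e m) x y) by near: m.
  have m0 : (0 < m)%N by near: m; exact: nbhs_infty_gt.
  rewrite !rE !mulrA -[m%:R * _ * _]mulrA invfM mulrACA divff ?mul1r//.
  by rewrite mulf_neq0 ?pnatr_eq0 -?lt0n// gt_eqF.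
have za_s := threshold_excess HA vE' sigma_gt0 zaE.
have zb_s := threshold_excess HA vE' sigma_gt0 zbE.
have ABOSE : ABOS (fun m => R_of m (ta m) (tb m)) (fun m => R_of m (a m) (b m))
    <-> near_optimal nu s e df ta tb.
  have <- := ratio_cvg1_near_optimal sigma_gt0 c0_gt0 L_cvg e_gt0 sE dfE df_ge reg
    oracle_sign oracle_opt sgn.
  rewrite /ABOS; split; apply: cvg_trans; apply: near_eq_cvg => //.
  by apply: filterS ratioE => m ->.
rewrite ABOSE (near_optimal_thresholds sigma_gt0 c0_gt0 L_cvg e_gt0 sE dfE df_ge reg sgn).
have [a1 a2] : (forall k, 0 < k -> \forall m \near \oo, - ta m / s m <= 1 + k) /\
    (forall A, \forall m \near \oo, A <= excess L m (- ta m / s m)) <->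
    za =o_\oo L /\ (za m + 2 * ln (L m)) @[m --> \oo] --> +oo.
  apply: (threshold_conditions L_cvg e_gt0 sE).
    by move=> m sm; rewrite divr_gt0// oppr_gt0; case/andP: (sgn m).
  by apply: filterS za_s => m ->; rewrite mulNr sqrrN.
have [b1 b2] : (forall k, 0 < k -> \forall m \near \oo, tb m / s m <= 1 + k) /\
    (forall A, \forall m \near \oo, A <= excess L m (tb m / s m)) <->
    zb =o_\oo L /\ (zb m + 2 * ln (L m)) @[m --> \oo] --> +oo.
  apply: (threshold_conditions L_cvg e_gt0 sE) => //.
  by move=> m sm; rewrite divr_gt0//; case/andP: (sgn m).
split=> [[xk yk xA yA]|[oa ob la lb]].
  by have [? ?] := a1 (conj xk xA); have [? ?] := b1 (conj yk yA); split.
by have [? ?] := a2 (conj oa la); have [? ?] := b2 (conj ob lb); split.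
Unshelve. all: end_near. Qed.
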